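(* Let $k\in\omega$ and let $F=\langle F_{d,t}\mid d,t\in\omega,\ d\ge t\rangle$ be a family of $k$-ary functions, each $F_{d,t}$ defined on $\mathbf M_d$ with values in $\{0,1\}$. If $F$ is polynomial time computable with respect to $\mathbf M$, then $F$ is polynomially existential in $\mathbf M$.
   Context: $\mathcal M$ is the first-order language with equality with constant symbols $\mathbf 0,\mathbf 1,-\mathbf 1,\mathbf n$, unary function symbols $\mathcal N,\mathbf p$, binary function symbols $+,\times,\div,\max,\min,\cap$. For $d\in\omega$, $n=2^d$, $\mathbf M_d$ has universe $\{0,\dots,2^n-1\}$ with $+,\times$ modulo $2^n$, $\mathbf p(x)=\min\{2^x,2^n-1\}$, $\div(x,y)=\lfloor x/y\rfloor$ ($0$ if $y=0$), constants $0,1,n,2^n-1$, usual $\max,\min$, bitwise AND $\cap$ and bitwise complement $\mathcal N$ on $n$-bit representations. $N_m$ is a random access machine with word length $m$ and $2^m$ memory cells, whose finite instruction set (independent of $m$) includes instructions computing each $\mathcal M$-operation of $\mathbf M_d$ in one step when $m=2^d$, together with read/write, control transfer, input/output and halt instructions. The family $F$ is polynomial time computable with respect to $\mathbf M$ if there exist $\gamma_1\in\omega$ and a program $P$ such that for all sufficiently large $d$, all $t\le d$ and all $a_0,\dots,a_{k-1}\in\mathbf M_d$, the machine $N_m$, $m=2^d$, started with the program in the first $\mathrm{length}(P)$ cells and the input $k,d,t,a_0,\dots,a_{k-1}$ in the next $3+k$ cells (in this order), using only the first $2^{\gamma_1(d-t)}$ memory cells and in time $2^{\gamma_1(d-t)}$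 computes $F_{d,t}(a_0,\dots,a_{k-1})$. The family $F$ is polynomially existential in $\mathbf M$ if there exist $c\in\omega$ and an existential first-order formula $\psi(x_0,\dots,x_{k-1},y,z,w)$ of $\mathcal M$ such that for all $d\ge t$, all $a_0,\dots,a_{k-1},b\in\mathbf M_d$ and all $v\ge t+c(d-t)$: $F_{d,t}(a_0,\dots,a_{k-1})=b$ iff $\mathbf M_v\models\psi(a_0,\dots,a_{k-1},b,d,t)$. *)

(* Defs.v *)
From mathcomp Require Import all_boot.

Set Implicit Arguments.
Unset Strict Implicit.
Unset Printing Implicit Defensive.

(* Words of length m, identified with {0, ..., 2^m - 1}. *)
Definition word (m : nat) : Type := 'I_(2 ^ m).

Lemma word_card_gt0 (m : nat) : 0 < 2 ^ m.
Proof. by rewrite expn_gt0. Qed.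

Definition to_word (m x : nat) : word m := Ordinal (ltn_pmod x (word_card_gt0 m)).

Definition bit (x i : nat) : bool := odd (x %/ 2 ^ i).

Inductive Mconst := Czero | Cone | Cminus_one | Cn.
Inductive Munop := Ucompl | Upow.
Inductive Mbinop := Badd | Bmul | Bdiv | Bmax | Bmin | Bcap.

Inductive Mterm :=
  | TVar of nat
  | TConst of Mconst
  | TUn of Munop & Mterm
  | TBin of Mbinop & Mterm & Mterm.

Inductive Mformula :=
  | FEq of Mterm & Mterm
  | FNot of Mformula
  | FAnd of Mformula & Mformula
  | FOr of Mformula & Mformula
  | FImp of Mformula & Mformula
  | FEx of nat & Mformula
  | FAll of nat & Mformula.

Fixpoint term_vars (u : Mterm) : seq nat :=
  match u with
  | TVar i => [:: i]
  | TConst _ => [::]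
  | TUn _ u1 => term_vars u1
  | TBin _ u1 u2 => term_vars u1 ++ term_vars u2
  end.

Fixpoint free_vars (p : Mformula) : seq nat :=
  match p with
  | FEq u1 u2 => term_vars u1 ++ term_vars u2
  | FNot q => free_vars q
  | FAnd q r | FOr q r | FImp q r => free_vars q ++ free_vars r
  | FEx i q | FAll i q => [seq j <- free_vars q | j != i]
  end.

Fixpoint quantifier_free (p : Mformula) : bool :=
  match p with
  | FEq _ _ => true
  | FNot q => quantifier_free q
  | FAnd q r | FOr q r | FImp q r => quantifier_free q && quantifier_free r
  | FEx _ _ | FAll _ _ => false
  end.

Fixpoint existential (p : Mformula) : bool :=
  if p is FEx _ q then existential q else quantifier_free p.

(* The operations are defined on words of any length m, the constant n being
   interpreted as m; the structure M_d is the case m = 2^d. *)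

Definition const_sem (m : nat) (c : Mconst) : word m :=
  to_word m match c with
            | Czero => 0
            | Cone => 1
            | Cminus_one => 2 ^ m - 1
            | Cn => m
            end.

Definition unop_sem (m : nat) (f : Munop) (x : word m) : word m :=
  to_word m match f with
            | Ucompl => \sum_(i < m) (~~ bit x i) * 2 ^ i
            | Upow => minn (2 ^ x) (2 ^ m - 1)
            end.

(* In ssrnat, x %/ 0 = 0. *)
Definition binop_sem (m : nat) (f : Mbinop) (x y : word m) : word m :=
  to_word m match f with
            | Badd => x + y
            | Bmul => x * y
            | Bdiv => x %/ y
            | Bmax => maxn x y
            | Bmin => minn x y
            | Bcap => \sum_(i < m) (bit x i && bit y i) * 2 ^ i
            end.

Definition upd (A : eqType) (B : Type) (f : A -> B) (a : A) (b : B) : A -> B :=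
  fun a' => if a' == a then b else f a'.

Fixpoint term_sem (m : nat) (e : nat -> word m) (u : Mterm) : word m :=
  match u with
  | TVar i => e i
  | TConst c => const_sem m c
  | TUn f u1 => unop_sem f (term_sem e u1)
  | TBin f u1 u2 => binop_sem f (term_sem e u1) (term_sem e u2)
  end.

Fixpoint sat (m : nat) (e : nat -> word m) (p : Mformula) : Prop :=
  match p with
  | FEq u1 u2 => term_sem e u1 = term_sem e u2
  | FNot q => ~ sat e q
  | FAnd q r => sat e q /\ sat e r
  | FOr q r => sat e q \/ sat e r
  | FImp q r => sat e q -> sat e r
  | FEx i q => exists x : word m, sat (upd e i x) q
  | FAll i q => forall x : word m, sat (upd e i x) q
  end.

Definition M (d : nat) : Type := word (2 ^ d).

(* M_v |= p(s_0, s_1, ...), the i-th variable taking the value s_i. *)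
Definition M_sat (v : nat) (p : Mformula) (s : seq nat) : Prop :=
  sat (fun i => to_word (2 ^ v) (nth 0 s i)) p.

(* The random access machine N_m.  A stored instruction consists of four
   consecutive cells  op x y z ; the operands x, y, z are cell addresses. *)

Inductive opcode :=
  | OHalt
  | OConst of Mconst      (* [z] := c *)
  | OUn of Munop          (* [z] := f [x] *)
  | OBin of Mbinop        (* [z] := f [x] [y] *)
  | ORead                 (* [z] := [[x]] *)
  | OWrite                (* [[z]] := [x] *)
  | OJump                 (* goto z *)
  | OJumpEq               (* if [x] = [y] goto z *)
  | OJumpLe               (* if [x] <= [y] goto z *)
  | OInput                (* [z] := next word of the input tape, 0 if none *)
  | OOutput.              (* output register := [x] *)

(* The code of an instruction is its position in this list. *)
Definition opcodes : seq opcode :=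
  [:: OHalt;
      OConst Czero; OConst Cone; OConst Cminus_one; OConst Cn;
      OUn Ucompl; OUn Upow;
      OBin Badd; OBin Bmul; OBin Bdiv; OBin Bmax; OBin Bmin; OBin Bcap;
      ORead; OWrite; OJump; OJumpEq; OJumpLe; OInput; OOutput].

Record config (m : nat) := Config {
  mem : word m -> word m;
  pc : word m;
  intape : seq (word m);
  outreg : word m }.

Section Machine.
Variable m : nat.
Implicit Type s : config m.

Definition fetch_addr s (i : nat) : word m := to_word m (pc s + i).
Definition fetch s (i : nat) : word m := mem s (fetch_addr s i).

(* Words that are not instruction codes halt the machine. *)
Definition current_op s : opcode := nth OHalt opcodes (fetch s 0).

Definition halted s : bool := if current_op s is OHalt then true else false.

Definition step s : config m :=
  let x := fetch s 1 in
  let y := fetch s 2 in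
  let z := fetch s 3 in
  let next := fetch_addr s 4 in
  let set a w := Config (upd (mem s) a w) next (intape s) (outreg s) in
  let goto a := Config (mem s) a (intape s) (outreg s) in
  match current_op s with
  | OHalt => s
  | OConst c => set z (const_sem m c)
  | OUn f => set z (unop_sem f (mem s x))
  | OBin f => set z (binop_sem f (mem s x) (mem s y))
  | ORead => set z (mem s (mem s x))
  | OWrite => set (mem s z) (mem s x)
  | OJump => goto z
  | OJumpEq => goto (if mem s x == mem s y then z else next)
  | OJumpLe => goto (if mem s x <= mem s y then z else next)
  | OInput => Config (upd (mem s) z (head (to_word m 0) (intape s))) next
                     (behead (intape s)) (outreg s)
  | OOutput => Config (mem s) next (intape s) (mem s x)
  end.

(* The addresses of all cells fetched, read or written when executing the
   current instruction. *)
Definition accessed s : seq (word m) :=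
  let x := fetch s 1 in
  let y := fetch s 2 in
  let z := fetch s 3 in
  [seq fetch_addr s i | i <- iota 0 4] ++
  match current_op s with
  | OHalt | OJump => [::]
  | OConst _ | OInput => [:: z]
  | OUn _ => [:: x; z]
  | OBin _ => [:: x; y; z]
  | ORead => [:: x; mem s x; z]
  | OWrite => [:: x; z; mem s z]
  | OJumpEq | OJumpLe => [:: x; y]
  | OOutput => [:: x]
  end.

(* The initial contents of the cells are given by l, padded with zeros. *)
Definition init_config (l : seq nat) : config m :=
  Config (fun a => to_word m (nth 0 l a)) (to_word m 0) [::] (to_word m 0).

(* Started with l in its first cells, N_m reaches a halt instruction after at
   most T steps, having used only the first S cells, with output b. *)
Definition computes (l : seq nat) (S T : nat) (b : word m) : Prop :=
  exists2 i, i <= T &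
    [/\ halted (iter i step (init_config l)),
        outreg (iter i step (init_config l)) = b &
        forall j, j <= i ->
          all (fun a : word m => a < S) (accessed (iter j step (init_config l)))].

End Machine.

(* Families of k-ary functions F_{d,t} on M_d; only the values for t <= d are
   relevant. *)
Definition fun_family (k : nat) : Type := forall d t : nat, k.-tuple (M d) -> M d.

Definition zero_one_valued (k : nat) (F : fun_family k) : Prop :=
  forall (d t : nat) (a : k.-tuple (M d)), t <= d ->
    (F d t a : nat) = 0 \/ (F d t a : nat) = 1.

(* The cells that hold the program and the input at the start are always
   available, even when d - t is so small that there are more than
   2^(gamma1 (d - t)) of them (for t = d the latter number is 1). *)
Definition poly_time_computable (k : nat) (F : fun_family k) : Prop :=
  exists (gamma1 : nat) (P : seq nat) (d0 : nat),
    forall (d t : nat) (a : k.-tuple (M d)), d0 <= d -> t <= d ->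
      computes (P ++ [:: k; d; t] ++ [seq (x : nat) | x : M d <- a])
               (maxn (size P + (3 + k)) (2 ^ (gamma1 * (d - t))))
               (2 ^ (gamma1 * (d - t)))
               (F d t a).

(* The variables x_0, ..., x_{k-1}, y, z, w are those numbered 0, ..., k + 2.
   As soon as c >= 1 we have v >= d, so a, b, d, t are elements of M_v; and
   the condition for c = 0 implies the one for c = 1. *)
Definition poly_existential (k : nat) (F : fun_family k) : Prop :=
  exists (c : nat) (psi : Mformula),
    [/\ existential psi,
        all (fun i => i < k + 3) (free_vars psi) &
        forall (d t : nat) (a : k.-tuple (M d)) (b : M d) (v : nat),
          t <= d -> t + c * (d - t) <= v ->
          (F d t a = b <->
           M_sat v psi ([seq (x : nat) | x : M d <- a] ++ [:: b : nat; d; t]))].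

(* Main.v *)
Require Import Defs.
From mathcomp Require Import all_boot.
From mathcomp Require Import zify.
Import Defs.
Set Implicit Arguments.
Unset Strict Implicit.
Unset Printing Implicit Defensive.

(**
A computation of [N_m], [m = 2 ^ d], that takes [2 ^ (g1 (d - t))] steps on as many
cells is a square tableau whose rows are the successive memory contents. The words
of [M_v] have [2 ^ (d + (c - 1) (d - t))] bits, so that for large [c] a single
element of [M_v] holds the whole tableau, one cell per digit in base
[b = 2 ^ (O(m))]; the correctness of the tableau is checked simultaneously for all
cells by a fixed number of operations of [M_v]:

- Sums, intersections, shifts and, via a guard bit, comparisons act on all digits at
  once. The digitwise product is read off the diagonal of the outer product of two
  vectors and compressed by a reduction modulo [base - 1].
- In each row the fetched instruction and its operands are guessed, and confronted
  with the column whose address they name.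
- The powers [2 ^ x], [x < m], are handled by writing [x = xh * E + xl] with
  [E = 2 ^ ceil (d / 2)] and [Q = 2 ^ E]. The powers [Q ^ y] with [y < E] are exactly
  the divisors of [Q ^ E] of the form [1 + y (Q - 1) + h (Q - 1) ^ 2], and
  [2 ^ xl = Q ^ xl] modulo [Q - 2].

For [t = d] only one step is made, and finitely many values of [d] are tabulated.
*)

(** * Bits and digits *)

(** What is asked of a cell is a fixed Boolean combination of equations and inequalities, while
    terms only combine whole elements of [M_v]. Addition and intersection respect digits as long as
    none overflows; this is why every pointwise expression gets a syntactic degree. The program
    being fixed, the final degree is a constant, and so is the ratio between the width of a digit
    and [m]. Division is not digitwise and is expressed by products with guessed results and
    remainders; for the power, repeated squaring would need a number of guesses per row that grows
    with [d], whence the detour through divisors and congruences. No quantifier over cells is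
    available to say that a guess is a well-formed tableau. Instead, masks decode every element of
    [M_v] into some tableau with bounded entries. The side of the square exceeds the time and space
    bounds by a factor [2 ^ ((L + 4) (d - t))], [L] being the length of the initial memory, so that
    a halted last row and complete instructions fit. This factor is 1 for [t = d], which is
    therefore a case of its own. *)

Lemma bit_small (m x i : nat) : x < 2 ^ m -> m <= i -> bit x i = false.
Proof.
move=> lt_x le_mi; rewrite /bit divn_small //.
by apply: leq_trans lt_x _; rewrite leq_exp2l.
Qed.

Lemma bit_half (x i : nat) : bit x i.+1 = bit x./2 i.
Proof. by rewrite /bit expnS divnMA divn2. Qed.

Lemma bit_inj (x y : nat) : (forall i, bit x i = bit y i) -> x = y.
Proof.
elim/ltn_ind: x y => x IH y eq_xy.
have eq0 : odd x = odd y by have := eq_xy 0; rewrite /bit !divn1.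
have [x0 | x_gt0] := posnP x; last first.
  have eqh : x./2 = y./2.
    by apply: IH => [|i]; [lia | rewrite -!bit_half].
  by rewrite -(odd_double_half x) -(odd_double_half y) eq0 eqh.
rewrite x0 in eq_xy *; case: (posnP y) => [-> //|y_gt0].
(* The leading bit of [y], at position [trunc_log 2 y], tells it apart from 0. *)
have := eq_xy (trunc_log 2 y); rewrite /bit div0n.
have /andP[le1 lt1] := trunc_log_bounds (isT : 1 < 2) y_gt0.
suff -> : y %/ 2 ^ trunc_log 2 y = 1 by [].
apply/eqP; rewrite eqn_leq divn_gt0 ?expn_gt0 // le1 andbT -ltnS.
by rewrite ltn_divLR ?expn_gt0 // -expnS.
Qed.

Lemma bit_block (w a x i : nat) : a < 2 ^ w ->
  bit (a + 2 ^ w * x) i = if i < w then bit a i else bit x (i - w).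
Proof.
move=> lt_a; rewrite /bit; case: ltnP => [lt_iw | le_wi].
  have -> : 2 ^ w = 2 ^ i * 2 ^ (w - i) by rewrite -expnD subnKC // ltnW.
  rewrite -mulnA addnC mulnC divnMDl ?expn_gt0 // oddD mulnC.
  have -> : 2 ^ (w - i) = 2 * 2 ^ (w - i).-1 by rewrite -expnS prednK // subn_gt0.
  by rewrite mulnCA oddM.
have -> : 2 ^ i = 2 ^ w * 2 ^ (i - w) by rewrite -expnD subnKC.
by rewrite divnMA addnC mulnC divnMDl ?expn_gt0 // (divn_small lt_a) addn0.
Qed.

Lemma bit_modn (k x i : nat) : bit (x %% 2 ^ k) i = (i < k) && bit x i.
Proof.
have lt_x : x %% 2 ^ k < 2 ^ k by rewrite ltn_mod expn_gt0.
rewrite {2}(divn_eq x (2 ^ k)) addnC mulnC bit_block //.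
by case: ltnP => // le_ki; rewrite (bit_small lt_x).
Qed.

Lemma sum_bits_lt (c : nat -> bool) m : \sum_(i < m) c i * 2 ^ i < 2 ^ m.
Proof.
elim: m => [|m IH]; first by rewrite big_ord0.
rewrite big_ord_recr /= expnS mul2n -addnn -addSn leq_add //.
by case: (c m); rewrite ?mul1n.
Qed.

Lemma bit_sum (c : nat -> bool) m j :
  bit (\sum_(i < m) c i * 2 ^ i) j = (j < m) && c j.
Proof.
elim: m => [|m IH]; first by rewrite big_ord0 /bit div0n.
rewrite big_ord_recr /= mulnC bit_block ?sum_bits_lt // IH.
case: (ltnP j m) => [lt_jm | le_mj]; first by rewrite ltnW.
rewrite ltnS; have [le_jm | lt_mj] := leqP j m.
  have -> : j = m by apply/eqP; rewrite eqn_leq le_jm le_mj.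
  by rewrite subnn /bit divn1; case: (c m).
by rewrite (@bit_small 1) ?subn_gt0 //; case: (c m).
Qed.

Lemma bit_pred_exp (k i : nat) : bit (2 ^ k - 1) i = (i < k).
Proof.
have -> : 2 ^ k - 1 = \sum_(j < k) true * 2 ^ j.
  rewrite subn1 predn_exp mul1n; apply: eq_bigr => j _; by rewrite mul1n.
by rewrite (bit_sum (fun=> true)) andbT.
Qed.

(** Summing over the positions below [x] loses nothing, as [x < 2 ^ x], and makes the intersection
    independent of the word length. *)
Definition capn (x y : nat) : nat := \sum_(i < x) (bit x i && bit y i) * 2 ^ i.

Lemma bit_capn x y i : bit (capn x y) i = bit x i && bit y i.
Proof.
rewrite (bit_sum (fun i => bit x i && bit y i)); case: ltnP => //= le_xi.
by rewrite (@bit_small x) // ltn_expl.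
Qed.

Lemma sum_bits_capn m x y : x < 2 ^ m ->
  \sum_(i < m) (bit x i && bit y i) * 2 ^ i = capn x y.
Proof.
move=> lt_x; apply: bit_inj => i.
rewrite (bit_sum (fun i => bit x i && bit y i)) bit_capn; case: ltnP => //= le_xi.
by rewrite (bit_small lt_x).
Qed.

Lemma capn_lt m x y : x < 2 ^ m -> capn x y < 2 ^ m.
Proof. by move=> lt_x; rewrite -(sum_bits_capn y lt_x) (sum_bits_lt (fun i => bit x i && bit y i)). Qed.

Lemma capnC x y : capn x y = capn y x.
Proof. by apply: bit_inj => i; rewrite !bit_capn andbC. Qed.

Lemma capn_pred_exp x k : capn x (2 ^ k - 1) = x %% 2 ^ k.
Proof. by apply: bit_inj => i; rewrite bit_capn bit_pred_exp bit_modn andbC. Qed.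

Lemma capn_modl k x y : y < 2 ^ k -> capn x y = capn (x %% 2 ^ k) y.
Proof.
move=> lt_y; apply: bit_inj => i; rewrite !bit_capn bit_modn.
by case: ltnP => //= le_ki; rewrite (bit_small lt_y) // andbF.
Qed.

Lemma sum_bits_compl m x : x < 2 ^ m ->
  \sum_(i < m) (~~ bit x i) * 2 ^ i + x + 1 = 2 ^ m.
Proof.
move=> lt_x.
have Ex : x = \sum_(i < m) bit x i * 2 ^ i.
  apply: bit_inj => i; rewrite (bit_sum (bit x)); case: ltnP => //= le_xi.
  by rewrite (bit_small lt_x).
rewrite {2}Ex -big_split /= (eq_bigr (fun i : 'I_m => 2 ^ i)); last first.
  by move=> i _; rewrite -mulnDl; case: bit; rewrite mul1n.
by have := predn_exp 2 m; rewrite mul1n => <-; rewrite addn1 prednK // expn_gt0.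
Qed.

(** * Vectors packed as the digits of a number *)

Definition pack (c N : nat) (f : nat -> nat) : nat := \sum_(j < N) f j * c ^ j.

Lemma eq_pack c N f g : (forall j, j < N -> f j = g j) -> pack c N f = pack c N g.
Proof. by move=> eqfg; apply: eq_bigr => j _; rewrite eqfg. Qed.

Lemma packS c N f : pack c N.+1 f = f 0 + c * pack c N (fun j => f j.+1).
Proof.
rewrite /pack big_ord_recl muln1 big_distrr; congr (_ + _); apply: eq_bigr => j _.
by rewrite /= /bump /= add1n expnS mulnCA.
Qed.

Lemma packSr c N f : pack c N.+1 f = pack c N f + f N * c ^ N.
Proof. by rewrite /pack big_ord_recr. Qed.

Lemma packD c N f g : pack c N f + pack c N g = pack c N (fun j => f j + g j).
Proof. by rewrite /pack -big_split /=; apply: eq_bigr => j _; rewrite mulnDl. Qed.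

Lemma packZ c N f a : a * pack c N f = pack c N (fun j => a * f j).
Proof. by rewrite /pack big_distrr /=; apply: eq_bigr => j _; rewrite mulnA. Qed.

Lemma pack_lt c N f : (forall j, j < N -> f j < c) -> pack c N f < c ^ N.
Proof.
elim: N => [|N IH] lt_f; first by rewrite /pack big_ord0.
have /IH lt_p : forall j, j < N -> f j < c by move=> j lt_j; apply: lt_f; lia.
rewrite packSr expnS.
have := lt_f N (ltnSn _); nia.
Qed.

(** Moving entry [j] by [j] further digits only changes the base: the diagonal of a matrix with rows
    of base [c] is again an evenly spaced vector. Hence diagonal masks are geometric series. *)
Lemma pack_sum_exp b c N f :
  pack c N (fun j => f j * b ^ j) = pack (c * b) N f.
Proof. by apply: eq_bigr => j _; rewrite expnMn -mulnA (mulnC (b ^ j)). Qed.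

Lemma pack_cap w N f g :
  (forall j, j < N -> f j < 2 ^ w) -> (forall j, j < N -> g j < 2 ^ w) ->
  capn (pack (2 ^ w) N f) (pack (2 ^ w) N g) = pack (2 ^ w) N (fun j => capn (f j) (g j)).
Proof.
elim: N f g => [|N IH] f g lt_f lt_g.
  by rewrite /pack !big_ord0 /capn big_ord0.
rewrite !packS -IH => [|j lt_j|j lt_j]; [|exact: lt_f|exact: lt_g].
have lt0f := lt_f 0 (ltn0Sn _); have lt0g := lt_g 0 (ltn0Sn _).
apply: bit_inj => i; rewrite bit_capn !bit_block ?capn_lt //.
by case: ifP; rewrite bit_capn.
Qed.

Lemma pack_digits c N x : 0 < c -> pack c N (fun j => x %/ c ^ j %% c) = x %% c ^ N.
Proof.
move=> c_gt0; elim: N => [|N IH]; first by rewrite /pack big_ord0 modn1.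
rewrite packSr IH.
have {3}-> : x = x %/ c ^ N %/ c * c ^ N.+1 + (x %% c ^ N + x %/ c ^ N %% c * c ^ N).
  rewrite {1}(divn_eq x (c ^ N)) {1}(divn_eq (x %/ c ^ N) c) expnS; lia.
rewrite modnMDl [RHS]modn_small //.
have lt1 : x %% c ^ N < c ^ N by rewrite ltn_mod expn_gt0 c_gt0.
have lt2 : (x %/ c ^ N %% c).+1 * c ^ N <= c * c ^ N by rewrite leq_mul2r ltn_mod c_gt0 orbT.
by rewrite expnS; apply: leq_trans _ lt2; rewrite mulSn ltn_add2r.
Qed.

Lemma pack_div c N f s : 0 < c -> (forall j, j < N -> f j < c) ->
  pack c N f %/ c ^ s = pack c N (fun j => if j + s < N then f (j + s) else 0).
Proof.
move=> c_gt0 lt_f; elim: s => [|s IH].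
  by rewrite divn1; apply: eq_pack => j lt_j; rewrite addn0 lt_j.
rewrite expnSr divnMA IH.
case: N lt_f {IH} => [|N] lt_f; first by rewrite /pack !big_ord0 div0n.
rewrite packS addnC mulnC divnMDl // divn_small ?addn0; last first.
  by case: ifP => // lt_s; apply: lt_f.
rewrite packSr addnS ltnS ltnNge leq_addr /= mul0n addn0.
by apply: eq_pack => j _; rewrite addSn addnS.
Qed.

Lemma pack_digit c N f j : 0 < c -> j < N -> (forall i, i < N -> f i < c) ->
  pack c N f %/ c ^ j %% c = f j.
Proof.
move=> c_gt0 lt_j lt_f; rewrite pack_div //; case: N lt_j lt_f => // N lt_j lt_f.
by rewrite packS add0n lt_j addnC mulnC modnMDl modn_small // lt_f.
Qed.

Lemma pack_inj c N f g : 0 < c -> (forall j, j < N -> f j < c) ->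
  (forall j, j < N -> g j < c) -> pack c N f = pack c N g ->
  forall j, j < N -> f j = g j.
Proof.
by move=> c_gt0 lt_f lt_g eqfg j lt_j; rewrite -(pack_digit c_gt0 lt_j lt_f) eqfg pack_digit.
Qed.

(** Casting out nines: the base is congruent to 1 modulo [c - 1], so a number is congruent to the
    sum of its digits, and the bound makes the residue that sum itself. *)
Lemma pack_modn_pred c N (f : nat -> nat) : \sum_(j < N) f j < c.-1 ->
  pack c N f %% c.-1 = \sum_(j < N) f j.
Proof.
move=> lt_s; case: c lt_s => [//|c] /= lt_s.
have [q ->] : exists q, pack c.+1 N f = q * c + \sum_(j < N) f j.
  elim: N {lt_s} => [|N [q IH]]; first by exists 0; rewrite /pack !big_ord0.
  have := predn_exp c.+1 N; rewrite /= => Ep.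
  have := expn_gt0 c.+1 N => /= Ec.
  exists (q + f N * \sum_(i < N) c.+1 ^ i).
  rewrite packSr IH big_ord_recr /= -(prednK Ec) Ep mulnS; nia.
by rewrite modnMDl modn_small.
Qed.

Lemma pack_const1 c N : 1 < c -> (c ^ N - 1) %/ (c - 1) = pack c N (fun=> 1).
Proof.
move=> c_gt1; rewrite !subn1 predn_exp mulKn; last by case: c c_gt1 => [|[]].
by apply: eq_bigr => j _; rewrite mul1n.
Qed.

(** Telescoping of [N * c ^ N] in [N]. Solved for [pack c N id], it makes the vector 0, 1, 2, ... of
    column addresses the value of a fixed term. *)
Lemma pack_idE c N : 0 < c ->
  N * c ^ N = pack c N id * (c - 1) + c * pack c N (fun=> 1).
Proof.
move=> c_gt0; elim: N => [|N IH]; first by rewrite /pack !big_ord0 muln0.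
rewrite !packSr mulnDl mulnDr mul1n addnACA -IH expnS mulnBr muln1.
have : 0 < c ^ N by rewrite expn_gt0 c_gt0.
set u := c ^ N => u0; nia.
Qed.

Lemma pack_id c N : 1 < c ->
  pack c N id = (N * c ^ N - c * pack c N (fun=> 1)) %/ (c - 1).
Proof. by move=> c_gt1; rewrite pack_idE 1?ltnW // addnK mulnK // subn_gt0. Qed.

(** [X] is arbitrary: the mask reads any number as a vector of [N] entries below [2 ^ w] and
    discards all other bits. Guessed elements are decoded in this way. *)
Lemma capn_mask b w N X : w <= b ->
  capn X (pack (2 ^ b) N (fun=> 2 ^ w - 1)) =
  pack (2 ^ b) N (fun j => X %/ (2 ^ b) ^ j %% 2 ^ w).
Proof.
move=> le_w.
have lt_m j : j < N -> (fun=> 2 ^ w - 1) j < 2 ^ b.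
  move=> _ /=; have : 2 ^ w <= 2 ^ b by rewrite leq_exp2l.
  have : 0 < 2 ^ w by rewrite expn_gt0.
  lia.
have := pack_lt lt_m; rewrite -expnM => /capn_modl ->.
rewrite expnM -pack_digits ?expn_gt0 // pack_cap => [|j _|//]; last first.
  by rewrite ltn_mod expn_gt0.
apply: eq_pack => j _; rewrite capn_pred_exp.
by rewrite modn_dvdm // -(subnK le_w) expnD dvdn_mull.
Qed.

Lemma capn_digit w N f j : j < N -> (forall i, i < N -> f i < 2 ^ w) ->
  capn (pack (2 ^ w) N f) ((2 ^ w - 1) * (2 ^ w) ^ j) = f j * (2 ^ w) ^ j.
Proof.
move=> lt_j lt_f.
have E h : h * (2 ^ w) ^ j = pack (2 ^ w) N (fun i => if i == j then h else 0).
  rewrite /pack (bigD1 (Ordinal lt_j)) //= eqxx big1 ?addn0 // => i ne_i.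
  by rewrite ifN ?mul0n //; apply: contra ne_i => /eqP E; apply/eqP/val_inj.
have w_gt0 : 0 < 2 ^ w by rewrite expn_gt0.
rewrite !E pack_cap // => [|i _]; last by case: ifP => _; lia.
apply: eq_pack => i lt_i; case: eqP => [-> | _].
  by rewrite capn_pred_exp modn_small // lt_f.
by rewrite capnC /capn big_ord0.
Qed.

(** * Digitwise products *)

Section PointwiseProduct.
Variables (w N : nat).
Let b := 2 ^ w.
Let mask c := (b - 1) * pack (c * b) N (fun=> 1).

Lemma maskE c : mask c = pack c N (fun j => (b - 1) * b ^ j).
Proof. by rewrite pack_sum_exp /mask packZ; apply: eq_pack => j _; rewrite muln1. Qed.

Lemma mask_lt L j : N <= L -> j < N -> (b - 1) * b ^ j < b ^ L.
Proof.
move=> leNL lt_j; have b0 : 0 < b by rewrite expn_gt0.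
have : b ^ j.+1 <= b ^ L by rewrite leq_pexp2l //; lia.
by have : 0 < b ^ j; rewrite ?expn_gt0 ?b0 // expnS; nia.
Qed.

(** The product lays [N] copies of the vector side by side, and the mask keeps entry [j] of copy
    [j]. Consecutive entries are then [N + 1] digits apart, which is room for multiplying each of
    them by a whole vector of [N] digits. *)
Lemma pack_spread x : (forall j, j < N -> x j < b) ->
  capn (pack b N x * pack (b ^ N) N (fun=> 1)) (mask (b ^ N)) = pack (b ^ N.+1) N x.
Proof.
move=> lt_x; rewrite maskE packZ expnSr -pack_sum_exp /b -expnM pack_cap.
- by apply: eq_pack => j lt_j; rewrite muln1 capn_digit.
- by move=> j lt_j; rewrite muln1 expnM; exact: pack_lt.
by move=> j lt_j; rewrite expnM; apply: mask_lt.
Qed.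

(* Row j of the outer product is x_j * pack y; the mask keeps its j-th digit,
   and reducing modulo (base - 1) adds up the rows. *)
Lemma pack_mul x y : 0 < N -> 1 < w ->
  (forall i j, i < N -> j < N -> x i * y j < b) ->
  (forall j, j < N -> x j < b) ->
  (forall j, j < N -> y j < b) ->
  capn (pack (b ^ N.+1) N x * pack b N y) (mask (b ^ N.+1)) %% (b ^ N.+1 - 1)
  = pack b N (fun j => x j * y j).
Proof.
move=> N_gt0 w_gt1 lt_xy lt_x lt_y.
have b4 : 4 <= b by exact: (@leq_pexp2l 2 2 w).
have lt_Y := pack_lt lt_y.
rewrite maskE mulnC packZ /b -expnM pack_cap; first last.
- by move=> j lt_j; rewrite expnM; apply: mask_lt.
- move=> j lt_j; rewrite expnM expnSr -/b.
  by have := lt_x _ lt_j; nia.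
rewrite (@eq_pack _ _ _ (fun j => x j * y j * b ^ j)); last first.
  move=> j lt_j; rewrite (mulnC _ (x j)) packZ capn_digit // => i lt_i; exact: lt_xy.
have lt_p : pack b N (fun j => x j * y j) < b ^ N by apply: pack_lt => j lt_j; apply: lt_xy.
rewrite subn1 pack_modn_pred //; apply: leq_trans lt_p _.
rewrite expnM -/b expnSr.
have : 0 < b ^ N by rewrite expn_gt0; lia.
nia.
Qed.

End PointwiseProduct.

(** * Terms whose value does not wrap around *)

Notation tzero := (TConst Czero).
Notation tone := (TConst Cone).
Notation tadd := (TBin Badd).
Notation tmul := (TBin Bmul).
Notation tdiv := (TBin Bdiv).
Notation tcap := (TBin Bcap).
Notation tpow := (TUn Upow).
Definition tnum (c : nat) : Mterm := iter c (fun u => tadd u tone) tzero.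
Definition tsub (u v : Mterm) : Mterm := tadd u (tmul (TConst Cminus_one) v).
Definition tpred (u : Mterm) : Mterm := tadd u (TConst Cminus_one).
Definition tmod (u v : Mterm) : Mterm := tsub u (tmul (tdiv u v) v).
(** A repunit: the geometric series of ratio [2 ^ w] with [n] terms, that is, the vector of [n]
    ones. Multiplying by it copies a value into all digits. *)
Definition trep (w n : Mterm) : Mterm := tdiv (tpred (tpow (tmul w n))) (tpred (tpow w)).

Lemma val_to_word m x : nat_of_ord (to_word m x) = x %% 2 ^ m.
Proof. by []. Qed.

Lemma to_wordE m x : x < 2 ^ m -> nat_of_ord (to_word m x) = x.
Proof. by move=> lt_x; rewrite val_to_word modn_small. Qed.

Lemma to_wordK m (x : word m) : to_word m x = x.
Proof. by apply: val_inj; rewrite /= modn_small. Qed.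

Section TermValues.
Variables (m : nat) (e : nat -> word m).

Definition teval (u : Mterm) (n : nat) : Prop := nat_of_ord (term_sem e u) = n.

Lemma teval_lt u n : teval u n -> n < 2 ^ m.
Proof. by move=> <-; apply: ltn_ord. Qed.

Lemma teval_var i x : nat_of_ord (e i) = x -> teval (TVar i) x.
Proof. by []. Qed.

Lemma teval_add u v x y : teval u x -> teval v y -> x + y < 2 ^ m -> teval (tadd u v) (x + y).
Proof. by rewrite /teval /= => -> -> lt; rewrite modn_small. Qed.

Lemma teval_mul u v x y : teval u x -> teval v y -> x * y < 2 ^ m -> teval (tmul u v) (x * y).
Proof. by rewrite /teval /= => -> -> lt; rewrite modn_small. Qed.

Lemma teval_div u v x y : teval u x -> teval v y -> teval (tdiv u v) (x %/ y).
Proof.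
move=> ux; move: (ux) => /teval_lt lt_x; move: ux; rewrite /teval /= => -> ->.
by rewrite modn_small //; apply: leq_ltn_trans (leq_div _ _) lt_x.
Qed.

Lemma teval_cap u v x y : teval u x -> teval v y -> teval (tcap u v) (capn x y).
Proof.
move=> ux vy; rewrite /teval /=.
have lt_x : term_sem e u < 2 ^ m by apply: ltn_ord.
by rewrite sum_bits_capn // ux vy modn_small // capn_lt // -ux.
Qed.

Lemma teval_pow u x : teval u x -> x < m -> teval (tpow u) (2 ^ x).
Proof.
rewrite /teval /= => -> lt_x; have lt2 : 2 ^ x < 2 ^ m by rewrite ltn_exp2l.
by rewrite (minn_idPl _) ?modn_small //; lia.
Qed.

Lemma teval_zero : teval tzero 0.
Proof. by rewrite /teval /= mod0n. Qed.

Lemma teval_one : 1 < 2 ^ m -> teval tone 1.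
Proof. by move=> lt; rewrite /teval /= modn_small. Qed.

Lemma teval_num c : c < 2 ^ m -> teval (tnum c) c.
Proof.
elim: c => [|c IH] lt_c; first exact: teval_zero.
have one : teval tone 1 by apply: teval_one; lia.
by have := teval_add (IH (ltnW lt_c)) one; rewrite addn1; apply.
Qed.

Lemma teval_pred u x : teval u x -> 0 < x -> teval (tpred u) (x - 1).
Proof.
move=> ux x_gt0; have lt_x := teval_lt ux; move: ux; rewrite /teval /= => ->.
have : 2 ^ m - 1 < 2 ^ m by lia.
move=> /modn_small ->; have -> : x + (2 ^ m - 1) = x - 1 + 2 ^ m by lia.
by rewrite modnDr modn_small //; lia.
Qed.

Lemma teval_sub u v x y : teval u x -> teval v y -> y <= x -> teval (tsub u v) (x - y).
Proof.
move=> ux vy le_yx; have lt_x := teval_lt ux; move: ux vy; rewrite /teval /= => -> ->.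
have : 2 ^ m - 1 < 2 ^ m by lia.
move=> /modn_small ->; rewrite modnDmr.
have -> : x + (2 ^ m - 1) * y = y * 2 ^ m + (x - y) by nia.
by rewrite modnMDl modn_small //; lia.
Qed.

Lemma teval_mod u v x y : teval u x -> teval v y -> teval (tmod u v) (x %% y).
Proof.
move=> ux vy; have lt_x := teval_lt ux; have le := leq_trunc_div x y.
have -> : x %% y = x - x %/ y * y by apply/eqP; rewrite -(eqn_add2l (x %/ y * y)) subnKC // -divn_eq.
apply: (teval_sub ux _ le); apply: (teval_mul (teval_div ux vy) vy).
exact: leq_ltn_trans le lt_x.
Qed.

Lemma teval_rep u v w n : teval u w -> teval v n -> 0 < w -> w * n < m -> w < m ->
  teval (trep u v) (pack (2 ^ w) n (fun=> 1)).
Proof.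
move=> uw vn w_gt0 lt1 lt2.
have c_gt1 : 1 < 2 ^ w by rewrite -{1}(expn0 2) ltn_exp2l.
rewrite -pack_const1 // -expnM; apply: teval_div; apply: teval_pred; rewrite ?expn_gt0 //.
  apply: teval_pow => //; apply: teval_mul => //.
  by apply: ltn_trans lt1 _; apply: ltn_expl.
by apply: teval_pow.
Qed.

End TermValues.

(** If one factor is spaced by [s] digits, the pair [(i, a)] with [a < s] gets the exponent
    [i * s + a], the number of a cell. With one factor constant, this copies a row vector to all
    columns or a column vector to all rows. *)
Lemma pack_outer b s n f g :
  pack (b ^ s) n g * pack b s f = pack b (n * s) (fun j => g (j %/ s) * f (j %% s)).
Proof.
elim: n => [|n IH]; first by rewrite /pack !big_ord0.
have split h q r : pack b (q + r) h = pack b r h + b ^ r * pack b q (fun j => h (r + j)).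
  elim: q => [|q IHq]; first by rewrite /pack !big_ord0 muln0 addn0.
  by rewrite addSn !packSr IHq -addnA mulnDr (addnC q) expnD mulnCA.
rewrite packSr mulnDl IH mulSn split -expnM (mulnC s n); congr (_ + _).
rewrite (mulnC (g n)) -mulnA packZ; congr (_ * _); apply: eq_pack => j lt_j.
by rewrite divnMDl ?(leq_ltn_trans _ lt_j) // divn_small // addn0 modnMDl modn_small.
Qed.

(** * Pointwise expressions on an [A * A] tableau *)

(* [PV] are cell variables, [PR] variables that depend only on the row, [PG]
   global parameters; [PAdr] is the column, [PFirst] the indicator of row 0, and
   [PNext] looks one row ahead (0 in the last row). *)
Inductive pexp :=
  | PV of nat | PR of nat | PG of nat | PC of nat | PAdr | PFirst
  | PNext of pexp
  | PAdd of pexp & pexp | PMul of pexp & pexp | PCap of pexp & pexp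
  | PLe of pexp & pexp.

Section Eval.
Variables (vc : nat -> nat -> nat -> nat) (vr : nat -> nat -> nat) (gv : nat -> nat).
Variable A : nat.

Fixpoint peval (p : pexp) (i a : nat) : nat :=
  match p with
  | PV x => vc x i a
  | PR x => vr x i
  | PG g => gv g
  | PC c => c
  | PAdr => a
  | PFirst => i == 0
  | PNext p => if i.+1 < A then peval p i.+1 a else 0
  | PAdd p q => peval p i a + peval q i a
  | PMul p q => peval p i a * peval q i a
  | PCap p q => capn (peval p i a) (peval q i a)
  | PLe p q => peval p i a <= peval q i a
  end.

(* Values are below [D ^ pdeg]. *)
Fixpoint pdeg (p : pexp) : nat :=
  match p with
  | PC c => c.+1
  | PNext p => pdeg p
  | PAdd p q => (pdeg p + pdeg q).+1
  | PMul p q | PCap p q | PLe p q => pdeg p + pdeg q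
  | _ => 1
  end.

Lemma pdeg_gt0 p : 0 < pdeg p.
Proof. by elim: p => //= *; rewrite addn_gt0; apply/orP; left. Qed.

Variable dw : nat.
Hypothesis dw_gt0 : 0 < dw.
Hypothesis vc_lt : forall x i a, vc x i a < 2 ^ dw.
Hypothesis vr_lt : forall x i, vr x i < 2 ^ dw.
Hypothesis gv_lt : forall g, gv g < 2 ^ dw.
Hypothesis A_lt : A < 2 ^ dw.

Lemma peval_lt p i a : a < A -> peval p i a < 2 ^ (dw * pdeg p).
Proof.
move=> lt_a; have D_gt1 : 1 < 2 ^ dw by rewrite -{1}(expn0 2) ltn_exp2l.
have mono x y z : x < 2 ^ (dw * y) -> x < 2 ^ (dw * (y + z)).
  by move=> lt; apply: leq_trans lt _; rewrite leq_exp2l // leq_mul2l leq_addr orbT.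
elim: p i => /= [x|x|g|c|||p IHp|p IHp q IHq|p IHp q IHq|p IHp q IHq|p IHp q IHq] i.
- by rewrite muln1.
- by rewrite muln1.
- by rewrite muln1.
- rewrite expnM; apply: leq_trans (ltn_expl _ D_gt1) _.
  by rewrite leq_exp2l.
- by rewrite muln1; apply: ltn_trans A_lt.
- by rewrite muln1; case: (i == 0) => //; apply: ltnW.
- by case: ifP => _; rewrite ?IHp // expn_gt0.
(* Both summands are below [D ^ (pdeg p + pdeg q)]; the additional unit of degree absorbs the factor
   2. *)
- have := mono _ _ (pdeg q) (IHp i); have := mono _ _ (pdeg p) (IHq i).
  rewrite (addnC (pdeg q)); set u := dw * _ => lt1 lt2.
  have : 2 ^ u.+1 <= 2 ^ (dw * (pdeg p + pdeg q).+1) by rewrite leq_exp2l // mulnS /u; lia.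
  by apply: leq_trans; rewrite expnS; lia.
- rewrite mulnDr expnD.
  have := IHp i; have := IHq i; set x := _ ^ _; set y := _ ^ _; nia.
- by rewrite capn_lt // mono.
by apply: leq_ltn_trans (leq_b1 _) _; rewrite -{1}(expn0 2) ltn_exp2l // muln_gt0 dw_gt0 addn_gt0 pdeg_gt0.
Qed.

End Eval.

(** * Translation of pointwise expressions into terms *)

Section Compile.
Variables (o : nat) (gt : nat -> Mterm) (tdw tA : Mterm) (K : nat).

(** A value of degree at most [K] takes [dw * K] bits; the digit has [dw] more, the lowest of which
    is the guard bit [tH] of comparisons. *)
Definition tw : Mterm := tmul tdw (tnum K.+1).
Definition tN : Mterm := tmul tA tA.
Definition tones : Mterm := trep tw tN.
Definition tmaskD : Mterm := tpred (tpow tdw).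
Definition tH : Mterm := tpow (tmul tdw (tnum K)).
Definition tshift : Mterm := tpow (tmul tw tA).
(** In a matrix whose rows have [N + s - 1] digits, digit [j] of row [j] is at position
    [j * (N + s)]. The case [s = 1] serves to spread a vector, [s = 2] to read off the diagonal of
    the outer product. *)
Definition tmask (s : nat) : Mterm :=
  tmul (tpred (tpow tw)) (trep (tmul tw (tadd tN (tnum s))) tN).

(** A row variable has one digit per row and is copied to all columns by a repunit; [PAdr] is the
    quotient of [pack_id] copied to all rows. Division by [tshift] drops the lowest row, so that
    [PNext] reads 0 in the last one. In [PLe], the guard bit is added to each digit of [q] before
    [p] is subtracted, and what survives of it is shifted down to 0 or 1. *)
Fixpoint pcomp (p : pexp) : Mterm :=
  match p with
  | PV x => tcap (TVar (o + x.*2)) (tmul tmaskD tones)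
  | PR x => tmul (tcap (TVar (o + x.*2.+1)) (tmul tmaskD (trep (tmul tw tA) tA))) (trep tw tA)
  | PG g => tmul (gt g) tones
  | PC c => tmul (tnum c) tones
  | PAdr => tmul (trep (tmul tw tA) tA)
                 (tdiv (tsub (tmul tA tshift) (tmul (tpow tw) (trep tw tA))) (tpred (tpow tw)))
  | PFirst => trep tw tA
  | PNext p => tdiv (pcomp p) tshift
  | PAdd p q => tadd (pcomp p) (pcomp q)
  | PMul p q =>
      tmod (tcap (tmul (tcap (tmul (pcomp p) (trep (tmul tw tN) tN)) (tmask 1)) (pcomp q))
                 (tmask 2))
           (tpred (tpow (tmul tw (tadd tN tone))))
  | PCap p q => tcap (pcomp p) (pcomp q)
  | PLe p q => tdiv (tcap (tsub (tadd (tmul tH tones) (pcomp q)) (pcomp p)) (tmul tH tones)) tH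
  end.

Variables (m : nat) (e : nat -> word m) (A dw : nat) (gv : nat -> nat).
Let w := dw * K.+1.
Let N := A * A.
Let b := 2 ^ w.

Hypothesis dw_gt1 : 1 < dw.
Hypothesis A_gt0 : 0 < A.
Hypothesis A_lt : A < 2 ^ dw.
Hypothesis tA_val : teval e tA A.
Hypothesis tdw_val : teval e tdw dw.
Hypothesis gt_val : forall g, teval e (gt g) (gv g).
Hypothesis gv_lt : forall g, gv g < 2 ^ dw.
(** The longest intermediate value is the diagonal mask of the outer product: its [N] entries are
    [N + 2] digits apart, and its repunit comes from the power [2 ^ (w * (N * (N + 2)))], which must
    not saturate. *)
Hypothesis m_big : w * (N * (N + 2)) < m.

(** Digits are cut down to [dw] bits, so the entries are bounded for every valuation and the formula
    need not restrict the witnesses. *)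
Definition cell_digits (x i a : nat) : nat := e (o + x.*2) %/ b ^ (i * A + a) %% 2 ^ dw.
Definition row_digits (x i : nat) : nat := e (o + x.*2.+1) %/ (b ^ A) ^ i %% 2 ^ dw.

Let ev := peval cell_digits row_digits gv A.
Let pk f := pack b N (fun j => f (j %/ A) (j %% A)).

Let N_gt0 : 0 < N. Proof. by rewrite muln_gt0 A_gt0. Qed.
Let w_ge : dw <= w. Proof. by rewrite /w leq_pmulr. Qed.
Let leAN : A <= N. Proof. by rewrite /N leq_pmulr. Qed.

Let exp_lt x : x <= N * (N + 2) -> w * x < m.
Proof. by move=> le; apply: leq_ltn_trans m_big; rewrite leq_mul2l le orbT. Qed.

Let ltm x y : y <= N * (N + 2) -> x < b ^ y -> x < 2 ^ m.
Proof.
move=> le lt; apply: ltn_trans lt _; rewrite /b -expnM ltn_exp2l //; exact: exp_lt.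
Qed.

Let small_lt x : x <= m -> x < 2 ^ m.
Proof. by move=> le; apply: leq_ltn_trans le _; apply: ltn_expl. Qed.

Let tw_val : teval e tw w.
Proof.
have : w * 1 < m by apply: exp_lt; nia.
rewrite muln1 => lt; apply: teval_mul => //; last by apply: small_lt; lia.
apply: teval_num; apply: small_lt; apply: leq_trans (ltnW lt).
by rewrite /w leq_pmull //; lia.
Qed.

Let tmulw u x : teval e u x -> x <= N * (N + 2) -> teval e (tmul tw u) (w * x).
Proof. by move=> ux le; apply: teval_mul => //; apply: small_lt; apply: ltnW; apply: exp_lt. Qed.

Let wm : w < m.
Proof. have : w * 1 < m by apply: exp_lt; nia. by rewrite muln1. Qed.

Let w_gt0 : 0 < w. Proof. lia. Qed.

Let lt_num x : x <= N * (N + 2) -> x < 2 ^ m.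
Proof.
move=> le; apply: small_lt; apply: leq_trans (ltnW (exp_lt le)).
by rewrite leq_pmull //; lia.
Qed.

Let tN_val : teval e tN N.
Proof. by apply: teval_mul => //; apply: lt_num; nia. Qed.

Let trep_val u v x y : teval e u x -> teval e v y -> 0 < x -> 0 < y -> x * y <= N * (N + 2) ->
  teval e (trep (tmul tw u) v) (pack (b ^ x) y (fun=> 1)).
Proof.
move=> ux vy x0 y0 le; rewrite /b -expnM; apply: teval_rep => //.
- apply: tmulw => //; nia.
- by rewrite muln_gt0 w_gt0.
- by rewrite -mulnA; apply: exp_lt.
by apply: exp_lt; nia.
Qed.

Let trep1_val v y : teval e v y -> y <= N * (N + 2) -> teval e (trep tw v) (pack b y (fun=> 1)).
Proof. by move=> vy le; apply: teval_rep => //; apply: exp_lt. Qed.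

Let tones_val : teval e tones (pack b N (fun=> 1)).
Proof. by apply: trep1_val => //; nia. Qed.

Let b_gt1 : 1 < b. Proof. by rewrite -{1}(expn0 2) ltn_exp2l. Qed.

Let pack_ltm s f : s <= N + 2 -> (forall j, j < N -> f j < b ^ s) -> pack (b ^ s) N f < 2 ^ m.
Proof.
move=> le lt_f; apply: (@ltm _ (s * N)); first by rewrite mulnC leq_mul2l le orbT.
by rewrite expnM; apply: pack_lt.
Qed.

Let pack1_ltm f : (forall j, j < N -> f j < b) -> pack b N f < 2 ^ m.
Proof.
by move=> lt_f; rewrite -(expn1 b); apply: pack_ltm => [|j /lt_f]; rewrite ?expn1 //; lia.
Qed.

Let const_val u c : teval e u c -> c < b -> teval e (tmul u tones) (pk (fun _ _ => c)).
Proof.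
move=> uc lt_c; have E : pk (fun _ _ => c) = c * pack b N (fun=> 1).
  by rewrite packZ; apply: eq_pack => j _; rewrite muln1.
by rewrite E; apply: teval_mul => //; rewrite -E; apply: pack1_ltm.
Qed.

Let D_lt : 2 ^ dw <= b. Proof. by rewrite leq_exp2l. Qed.

Let tmaskD_val : teval e tmaskD (2 ^ dw - 1).
Proof. apply: teval_pred; rewrite ?expn_gt0 //; apply: teval_pow => //; lia. Qed.

Let tshift_val : teval e tshift (b ^ A).
Proof. rewrite /b -expnM; apply: teval_pow; [apply: tmulw => //| apply: exp_lt]; nia. Qed.

Let tb_val : teval e (tpow tw) b. Proof. exact: teval_pow. Qed.

Let tmask_val s : 0 < s -> s <= 2 -> teval e (tmask s) ((b - 1) * pack (b ^ (N + s)) N (fun=> 1)).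
Proof.
move=> s_gt0 s_le; apply: teval_mul.
- by apply: teval_pred => //; lia.
- apply: trep_val => //; [|lia|nia]; apply: teval_add => //; [apply: teval_num|]; apply: lt_num; nia.
rewrite packZ; apply: pack_ltm => [|j _]; first by lia.
have : b ^ 1 <= b ^ (N + s) by rewrite leq_exp2l //; lia.
rewrite expn1; lia.
Qed.

Let tH_val : teval e tH (2 ^ (dw * K)).
Proof.
have ltw : dw * K <= w by rewrite /w leq_mul2l leqnSn orbT.
apply: teval_pow; last by lia.
apply: teval_mul => //; last by apply: small_lt; lia.
by apply: teval_num; apply: small_lt; have := wm; rewrite /w; nia.
Qed.

Lemma pcompP p : pdeg p <= K -> teval e (pcomp p) (pk (ev p)).
Proof.
have vc_lt x i a : cell_digits x i a < 2 ^ dw by rewrite ltn_mod expn_gt0.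
have vr_lt x i : row_digits x i < 2 ^ dw by rewrite ltn_mod expn_gt0.
have ev_lt0 q i a : a < A -> ev q i a < 2 ^ (dw * pdeg q).
  exact: (peval_lt (ltnW dw_gt1) vc_lt vr_lt gv_lt A_lt).
have ev_lt q i a : a < A -> pdeg q <= K -> ev q i a < 2 ^ (dw * K).
  by move=> /ev_lt0 lt le; apply: leq_trans (lt _ _) _; rewrite leq_exp2l // leq_mul2l le orbT.
have H_lt : 2 ^ (dw * K) < b by rewrite ltn_exp2l // ltn_mul2l leqnn andbT; lia.
have evb_lt q j : pdeg q <= K -> ev q (j %/ A) (j %% A) < b.
  by move=> le; apply: ltn_trans H_lt; apply: ev_lt; rewrite // ltn_mod.
elim: p => [x|x|g|c|||p IHp|p IHp q IHq|p IHp q IHq|p IHp q IHq|p IHp q IHq] /= degp.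
- have := capn_mask N (e (o + x.*2)) w_ge.
  rewrite (_ : pack _ _ (fun j => _ %/ _ %% _) = pk (ev (PV x))); last first.
    by apply: eq_pack => j _; rewrite /ev /= /cell_digits -divn_eq.
  move=> <-; apply: teval_cap => //.
  rewrite (_ : pack _ _ _ = pk (fun _ _ => 2 ^ dw - 1)) //; apply: const_val => //; lia.
- have := capn_mask A (e (o + x.*2.+1)) (_ : dw <= w * A).
  rewrite -/(row_digits x) => /(_ _) E; have {}E := E (leq_trans w_ge (leq_pmulr _ A_gt0)).
  have -> : pk (ev (PR x)) = pack (b ^ A) A (row_digits x) * pack b A (fun=> 1).
    by rewrite pack_outer; apply: eq_pack => j _; rewrite muln1.
  have ltR : pack (b ^ A) A (row_digits x) * pack b A (fun=> 1) < 2 ^ m.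
    rewrite pack_outer; apply: pack1_ltm => j _; rewrite muln1.
    by apply: leq_trans D_lt; rewrite ltn_mod expn_gt0.
  apply: teval_mul ltR; last by apply: trep1_val => //; nia.
  rewrite /row_digits -!expnM -E; apply: teval_cap => //.
  have -> : pack (2 ^ (w * A)) A (fun=> 2 ^ dw - 1) = (2 ^ dw - 1) * pack (b ^ A) A (fun=> 1).
    by rewrite packZ -expnM; apply: eq_pack => j _; rewrite muln1.
  apply: teval_mul => //; first by apply: trep_val => //; nia.
  rewrite packZ; apply: (@ltm _ (A * A)); first by rewrite -/N; nia.
  rewrite expnM; apply: pack_lt => j _; rewrite muln1.
  have : b ^ 1 <= b ^ A by rewrite leq_exp2l.
  rewrite expn1; have : 0 < 2 ^ dw by rewrite expn_gt0.
  by lia.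
- by apply: const_val => //; apply: leq_trans (gv_lt g) D_lt.
- have lt_c : c < b.
    have : 2 ^ c < b by rewrite ltn_exp2l //; nia.
    by apply: ltn_trans; apply: ltn_expl.
  apply: const_val => //; apply: teval_num; apply: ltn_trans lt_c _; rewrite ltn_exp2l //.
- have -> : pk (ev PAdr) = pack (b ^ A) A (fun=> 1) * pack b A id.
    by rewrite pack_outer; apply: eq_pack => j _; rewrite mul1n.
  have leA : pack b A id < b ^ A by apply: pack_lt => j lt_j; lia.
  have lt1 : pack b A (fun=> 1) < b ^ A by apply: pack_lt.
  have leA2 : A * b ^ A < 2 ^ m.
    apply: (@ltm _ A.+1); first by nia.
    by rewrite expnS ltn_mul2r expn_gt0 (ltnW b_gt1) /=; lia.
  have Eid := @pack_idE b A (ltnW b_gt1).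
  apply: teval_mul; first by apply: trep_val => //; nia.
    rewrite pack_id //; apply: teval_div; last by apply: teval_pred => //; lia.
    have le2 : b * pack b A (fun=> 1) <= A * b ^ A by rewrite Eid leq_addl.
    apply: teval_sub => //; first exact: teval_mul.
    by apply: teval_mul => //; [apply: trep1_val => //; nia | apply: leq_ltn_trans le2 leA2].
  rewrite pack_outer; apply: pack1_ltm => j _; rewrite mul1n.
  by have := ltn_pmod j A_gt0; lia.
- have -> : pk (ev PFirst) = pack b A (fun=> 1).
    have E1 : pack (b ^ A) A (fun i => i == 0) = 1.
      by case: (A) A_gt0 => // n _; rewrite packS /pack big1 // muln0.
    rewrite -[RHS]mul1n -[X in X * _]E1.
    by rewrite pack_outer; apply: eq_pack => j _; rewrite muln1.
  by apply: trep1_val => //; nia.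
- have -> : pk (ev (PNext p)) = pk (ev p) %/ b ^ A.
    rewrite pack_div => [||j _]; [|exact: ltnW|exact: evb_lt].
    apply: eq_pack => j lt_j; rewrite /ev /= -/ev.
    have -> : (j + A) %/ A = (j %/ A).+1 by rewrite divnDr // divnn A_gt0 addn1.
    rewrite modnDr; congr (if _ then _ else _).
    by rewrite /N -(ltn_divLR _ _ A_gt0) divnDr // divnn A_gt0 addn1.
  by apply: teval_div => //; apply: IHp.
- have -> : pk (ev (PAdd p q)) = pk (ev p) + pk (ev q) by rewrite packD.
  apply: teval_add; [apply: IHp; lia|apply: IHq; lia|].
  by rewrite packD; apply: pack1_ltm => j _; apply: (evb_lt (PAdd p q)).
- have lep : pdeg p <= K by lia.
  have leq : pdeg q <= K by lia.
  have lt_xy i j : i < N -> j < N -> ev p (i %/ A) (i %% A) * ev q (j %/ A) (j %% A) < b.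
    move=> _ _; apply: leq_trans (_ : _ < 2 ^ (dw * (pdeg p + pdeg q))) _; last first.
      by apply: leq_trans (ltnW H_lt); rewrite leq_exp2l // leq_mul2l degp orbT.
    rewrite mulnDr expnD.
    have lt r l : ev r (l %/ A) (l %% A) < 2 ^ (dw * pdeg r) by rewrite ev_lt0 // ltn_mod.
    have := lt p i; have := lt q j; set x := _ ^ _; set y := _ ^ _; nia.
  have lt_p j : j < N -> ev p (j %/ A) (j %% A) < b by move=> _; apply: evb_lt.
  have lt_q j : j < N -> ev q (j %/ A) (j %% A) < b by move=> _; apply: evb_lt.
  have w_gt1 : 1 < w by lia.
  rewrite -[pk (ev (PMul p q))](pack_mul N_gt0 w_gt1 lt_xy lt_p lt_q) -/b.
  have Es : b ^ N.+1 = b ^ (N + 1) by rewrite addn1.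
  have Es2 : b ^ N.+1 * b = b ^ (N + 2) by rewrite -expnSr addn2.
  rewrite Es2; apply: teval_mod; last first.
    apply: teval_pred; rewrite ?expn_gt0 ?(ltnW b_gt1) // /b -expnM; apply: teval_pow; last by apply: exp_lt; nia.
    apply: tmulw; last by nia.
    by rewrite -addn1; apply: teval_add => //; [apply: teval_one|]; apply: lt_num; nia.
  apply: teval_cap; last exact: tmask_val.
  have ltY : pk (ev q) < b ^ N by apply: pack_lt.
  apply: teval_mul; last first.
  + rewrite mulnC packZ Es; apply: pack_ltm => [|j lt_j]; first by lia.
    by rewrite addn1 expnSr; apply: ltn_mul => //; apply: lt_p.
  + exact: IHq.
  rewrite -pack_spread // -/b -expnSr Es; apply: teval_cap; last exact: tmask_val.
  apply: teval_mul; first exact: IHp.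
    by apply: trep_val => //; nia.
  rewrite packZ; apply: pack_ltm => [|j lt_j]; first by lia.
  by rewrite muln1; apply: pack_lt.
- have -> : pk (ev (PCap p q)) = capn (pk (ev p)) (pk (ev q)).
    by rewrite pack_cap // => j _; apply: evb_lt; lia.
  by apply: teval_cap; [apply: IHp | apply: IHq]; lia.
set H := 2 ^ (dw * K).
have lep : pdeg p <= K by lia.
have leq : pdeg q <= K by lia.
(* As [p] and [q] are below [H], each [H + q - p] lies strictly between 0 and [2 * H]: no borrow or
   carry leaves its digit, and the bit [H] is set exactly if [p <= q]. *)
have HH : H + H <= b.
  rewrite /H /b /w mulnS expnD addnn -mul2n leq_mul2r.
  by rewrite (@leq_pexp2l 2 1) ?orbT //; lia.
have lt_p j : ev p (j %/ A) (j %% A) < H by apply: ev_lt; rewrite // ltn_mod.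
have lt_q j : ev q (j %/ A) (j %% A) < H by apply: ev_lt; rewrite // ltn_mod.
have bH l : bit H l = (l == dw * K).
  have := @bit_block (dw * K) 0 1 l; rewrite muln1 add0n -/H => ->; last by rewrite expn_gt0.
  case: ltngtP => [lt|lt|->]; rewrite ?subnn //; first by rewrite /bit div0n.
  by rewrite (@bit_small 1) // subn_gt0.
have capH x : x < H + H -> capn x H = (H <= x) * H.
  move=> lt_x; apply: bit_inj => i; rewrite bit_capn.
  rewrite bH; case: eqP => [->|ne]; last first.
    by rewrite andbF; case: (_ <= _); rewrite ?mul1n ?bH; [case: eqP|rewrite /bit div0n].
  rewrite andbT {1}/bit -/H; case: leqP => [le|lt].
    rewrite mul1n bH eqxx (_ : x %/ H = 1) //; apply/eqP; rewrite eqn_leq divn_gt0 ?expn_gt0 // le andbT.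
    by rewrite -ltnS ltn_divLR ?expn_gt0 //; lia.
  by rewrite divn_small // /bit div0n.
have EH : H * pack b N (fun=> 1) = pack b N (fun=> H).
  by rewrite packZ; apply: eq_pack => j _; rewrite muln1.
have tHones : teval e (tmul tH tones) (pack b N (fun=> H)).
  by rewrite -EH; apply: teval_mul => //; rewrite EH; apply: pack1_ltm.
have Esub : pack b N (fun=> H) + pk (ev q) - pk (ev p)
    = pack b N (fun j => H + ev q (j %/ A) (j %% A) - ev p (j %/ A) (j %% A)).
  rewrite packD; apply/eqP; rewrite -(eqn_add2r (pk (ev p))) subnK; last first.
    by apply: leq_sum => j _; rewrite leq_mul2r; have := lt_p j; lia.
  by rewrite packD; apply/eqP/eq_pack => j _; have := lt_p j; lia.
have -> : pk (ev (PLe p q)) =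
    capn (pack b N (fun=> H) + pk (ev q) - pk (ev p)) (pack b N (fun=> H)) %/ H.
  rewrite Esub pack_cap => [|j _|j _]; [|by have := lt_q j; lia|by []].
  have -> : pack (2 ^ w) N (fun j => capn (H + ev q (j %/ A) (j %% A) - ev p (j %/ A) (j %% A)) H)
    = H * pk (ev (PLe p q)).
    rewrite packZ; apply: eq_pack => j _; rewrite capH; last by have := lt_q j; lia.
    rewrite mulnC /ev /= -/ev; congr (_ * nat_of_bool _); have := lt_p j; lia.
  by rewrite mulKn // expn_gt0.
apply: teval_div; last exact: tH_val.
apply: teval_cap => //; apply: teval_sub; [|exact: IHp|].
  apply: teval_add => //; first exact: IHq.
  by rewrite packD; apply: pack1_ltm => j _; have := lt_q j; lia.
rewrite packD; apply: leq_sum => j _; rewrite leq_mul2r; have := lt_p j; lia.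
Qed.

(** A condition counts as true where its value is positive. Comparison with 1 normalizes all values
    to 0 or 1, so that a single equation with the repunit speaks about all cells. *)
Definition tableau_formula (p : pexp) : Mformula := FEq (pcomp (PLe (PC 1) p)) tones.

Lemma sat_tableau p : pdeg (PLe (PC 1) p) <= K ->
  sat e (tableau_formula p) <-> forall i a, i < A -> a < A -> 0 < ev p i a.
Proof.
move=> le; have := pcompP le; rewrite /= /teval => E.
have -> : (term_sem e (pcomp (PLe (PC 1) p)) = term_sem e tones)
    <-> pk (ev (PLe (PC 1) p)) = pack b N (fun=> 1).
  by rewrite -E -tones_val; split=> [->|/val_inj].
split=> [Ep i a lt_i lt_a | all_p]; last first.
  apply: eq_pack => j lt_j; rewrite /ev /= all_p ?ltn_mod //.
  by rewrite ltn_divLR.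
have b_gt0 : 0 < b by lia.
have ltj : i * A + a < N by rewrite /N; nia.
have ltb c j : j < N -> nat_of_bool (c j) < b.
  by move=> _; apply: leq_ltn_trans (leq_b1 _) b_gt1.
have := pack_inj b_gt0 (ltb (fun j => 1 <= ev p (j %/ A) (j %% A))) (ltb (fun=> true)) Ep ltj.
rewrite divnMDl // divn_small // addn0 modnMDl modn_small // /ev /=.
by case: (0 < _).
Qed.

Lemma peval_ext vc vr vc' vr' p i a :
  (forall x i a, i < A -> a < A -> vc x i a = vc' x i a) ->
  (forall x i, i < A -> vr x i = vr' x i) -> i < A -> a < A ->
  peval vc vr gv A p i a = peval vc' vr' gv A p i a.
Proof.
move=> Ec Er lt_i lt_a; elim: p i lt_i => //= [x|p IHp|p IHp q IHq|p IHp q IHq|p IHp q IHq|p IHp q IHq] i lt_i.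
- exact: Ec.

- by case: ifP => // /IHp.
- by rewrite IHp // IHq.
- by rewrite IHp // IHq.
- by rewrite IHp // IHq.
by rewrite IHp // IHq.
Qed.

Variables (vc : nat -> nat -> nat -> nat) (vr : nat -> nat -> nat).
Hypothesis vc_lt : forall x i a, vc x i a < 2 ^ dw.
Hypothesis vr_lt : forall x i, vr x i < 2 ^ dw.
Hypothesis e_cell : forall x,
  nat_of_ord (e (o + x.*2)) = pack b N (fun j => vc x (j %/ A) (j %% A)).
Hypothesis e_row : forall x,
  nat_of_ord (e (o + x.*2.+1)) = pack (b ^ A) A (vr x).

Lemma sat_tableau_encode p : pdeg (PLe (PC 1) p) <= K ->
  (forall i a, i < A -> a < A -> 0 < peval vc vr gv A p i a) ->
  sat e (tableau_formula p).
Proof.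
move=> le all_p; apply/(sat_tableau le) => i a lt_i lt_a.
have dvD : 2 ^ dw %| b by rewrite /b -(subnK w_ge) expnD dvdn_mull.
rewrite /ev (@peval_ext _ _ vc vr) ?all_p // => [x {}i {}a {}lt_i {}lt_a | x {}i {}lt_i].
  rewrite /cell_digits e_cell -(modn_dvdm _ dvD) pack_digit; first last.
  - by move=> j _; apply: leq_trans D_lt.
  - by rewrite /N; nia.
  - by lia.
  by rewrite divnMDl // divn_small // addn0 modnMDl (modn_small lt_a) modn_small.
have dvA : 2 ^ dw %| b ^ A.
  by apply: dvdn_trans dvD _; rewrite -{1}(expn1 b) dvdn_exp2l.
have bA_gt0 : 0 < b ^ A by rewrite expn_gt0; lia.
rewrite /row_digits e_row -(modn_dvdm _ dvA) pack_digit // ?modn_small // => j _.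
by apply: leq_trans (vr_lt _ _) _; apply: dvdn_leq.
Qed.

End Compile.

(** * Parallel exponentiation *)

(** Binomial expansion to second order: for [x < q] the exponent is displayed as the second digit of
    the power in base [q]. *)
Lemma expn_mod_sqr q x : exists h, q.+1 ^ x = 1 + x * q + h * (q * q).
Proof.
elim: x => [|x [h IH]]; first by exists 0.
by exists (x + h * q + h); rewrite expnSr IH; nia.
Qed.

(** As a divisor of [2 ^ (E * E)], [w] is [2 ^ s = q.+1 ^ y * 2 ^ r] with [y <= E] and [r < E].
    Modulo [q] this is [2 ^ r], but [w] is 1 there, and [2 ^ r < q]; hence [r = 0]. Comparing modulo
    [q ^ 2] then yields [x = y] modulo [q], and both are below [q]. *)
Lemma power_recognition E q w x h : 1 < E -> q.+1 = 2 ^ E -> w %| 2 ^ (E * E) ->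
  w = 1 + x * q + h * (q * q) -> x < E -> w = q.+1 ^ x.
Proof.
move=> E_gt1 Eq /(dvdn_pfactor _ _ (isT : prime 2)) [s le_s Ew] Ewx lt_x.
have E_lt : E < q.
  have : E.+1 < 2 ^ E by elim: E E_gt1 {Eq le_s lt_x} => // -[|[|n]] // IH _; rewrite expnS; lia.
  by rewrite -Eq.
have E_gt0 : 0 < E by lia.
pose y := s %/ E; pose r := s %% E.
have Es : w = q.+1 ^ y * 2 ^ r by rewrite Eq -expnM -expnD Ew mulnC -divn_eq.
have [h' Ey] := expn_mod_sqr q y.
have r_lt : 2 ^ r < q.
  have : 2 ^ r <= 2 ^ E.-1 by rewrite leq_exp2l //; have := ltn_pmod s E_gt0; rewrite -/r; lia.
  have : 2 ^ E = 2 * 2 ^ E.-1 by rewrite -expnS prednK.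
  lia.
have r1 : 2 ^ r = 1.
  rewrite -(modn_small r_lt) -[LHS](modnMDl (y * 2 ^ r + h' * q * 2 ^ r)).
  rewrite (_ : _ + _ = w); last by rewrite Es Ey; lia.
  rewrite Ewx (_ : _ + _ = (x + h * q) * q + 1); last by lia.
  by rewrite modnMDl modn_small //; lia.
rewrite Es r1 muln1; congr (_ ^ _).
have y_lt : y < q.
  by apply: leq_ltn_trans E_lt; apply: leq_trans (leq_div2r E le_s) _; rewrite mulnK.
have x_lt : x < q by lia.
rewrite -(modn_small y_lt) -(modn_small x_lt) -[LHS](modnMDl h') -[RHS](modnMDl h).
by congr (_ %% _); rewrite Es r1 Ey in Ewx; nia.
Qed.

(* [2 ^ E = 2] modulo [2 ^ E - 2]. *)
Lemma expn_mod_sub2 E x : 2 < E -> x < E -> (2 ^ E) ^ x %% (2 ^ E - 2) = 2 ^ x.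
Proof.
move=> E_gt2 lt_x.
have : 2 ^ E = 2 * 2 ^ E.-1 by rewrite -expnS prednK //; lia.
have : 2 ^ x <= 2 ^ E.-1 by rewrite leq_exp2l //; lia.
(* With [u = 2 ^ E.-1 >= 4], the candidate [2 ^ x <= u] lies below the modulus [2 * u - 2]; this is
   where [E > 2] is needed. *)
have : 2 ^ 2 <= 2 ^ E.-1 by rewrite leq_exp2l //; lia.
rewrite (_ : 2 ^ 2 = 4) //; move: (2 ^ E.-1) => u u_ge le_u Eu.
have {1}-> : 2 ^ E = (2 ^ E - 2) + 2 by lia.
by rewrite -modnXm modnDl modnXm modn_small //; lia.
Qed.

(** * The tableau of a computation *)

(** Truth is positivity, so that conjunction and disjunction are plain product and sum; [PLe] turns
    a truth value back into 0 or 1. *)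
Definition PAnd := PMul.
Definition POr := PAdd.
Definition PNot p := PLe p (PC 0).
Definition PImp p q := POr (PNot p) q.
Definition PLt p q := PLe (PAdd p (PC 1)) q.
(* Not a product, lest [holds_and] unfold it. *)
Definition PEq p q := PLe (PC 2) (PAdd (PLe p q) (PLe q p)).

Declare Scope pexp_scope.
Delimit Scope pexp_scope with P.
Local Open Scope pexp_scope.
Infix "+" := PAdd : pexp_scope.
Infix "*" := PMul : pexp_scope.
Infix "&&" := PAnd : pexp_scope.
Infix "||" := POr : pexp_scope.
Notation "p ~> q" := (PImp p q) (at level 90, right associativity) : pexp_scope.
Infix "==" := PEq : pexp_scope.
Infix "<=" := PLe : pexp_scope.
Infix "<" := PLt : pexp_scope.
Local Close Scope pexp_scope.
Bind Scope pexp_scope with pexp.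

Section Holds.
Variables (vc : nat -> nat -> nat -> nat) (vr : nat -> nat -> nat) (gv : nat -> nat).
Variable A : nat.

Definition holds (p : pexp) (i a : nat) : bool := 0 < peval vc vr gv A p i a.
Local Notation ev p i a := (peval vc vr gv A p i a).

Lemma holds_and p q i a : holds (p && q)%P i a = holds p i a && holds q i a.
Proof. exact: muln_gt0. Qed.
Lemma holds_or p q i a : holds (p || q)%P i a = holds p i a || holds q i a.
Proof. exact: addn_gt0. Qed.
Lemma holds_not p i a : holds (PNot p) i a = ~~ holds p i a.
Proof. by rewrite /holds /= lt0b leqNgt. Qed.
Lemma holds_imp p q i a : holds (p ~> q)%P i a = (holds p i a ==> holds q i a).
Proof. by rewrite holds_or holds_not implybE. Qed.
Lemma holds_le p q i a : holds (p <= q)%P i a = (ev p i a <= ev q i a).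
Proof. exact: lt0b. Qed.
Lemma holds_lt p q i a : holds (p < q)%P i a = (ev p i a < ev q i a).
Proof. by rewrite holds_le /= addn1. Qed.
Lemma holds_eq p q i a : holds (p == q)%P i a = (ev p i a == ev q i a).
Proof. by rewrite [LHS]holds_le eqn_leq /=; do 2! case: (ev _ i a <= _). Qed.
Lemma holds_first i a : holds PFirst i a = (i == 0).
Proof. exact: lt0b. Qed.
Lemma holds_next p i a : holds (PNext p) i a = (i.+1 < A) && holds p i.+1 a.
Proof. by rewrite /holds /=; case: ifP. Qed.
Definition holdsE := (holds_eq, holds_imp, holds_not, holds_lt, holds_and, holds_or, holds_le).

End Holds.

(** [gb] is the output claimed. In each row, [rop], [rx], [ry], [rz] are the four cells of the
    instruction, [rvx], [rvy], [rvz] the contents of the cells they address, and [rvvx] that of the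
    cell addressed by [rvx]. The row writes [rres] to the address [rtgt] and passes [rnpc] and
    [rnout] on to the next one. The [raux] are guesses local to an operation. *)
Notation gA := (PG 0).      Notation gW := (PG 1).
Notation gm := (PG 2).      Notation gb := (PG 3).
Notation gE := (PG 4).      Notation gQ1 := (PG 5).
Notation gQ2 := (PG 6).     Notation gQE := (PG 7).
Notation rpc := (PR 0).     Notation rop := (PR 1).
Notation rx := (PR 2).      Notation ry := (PR 3).
Notation rz := (PR 4).      Notation rvx := (PR 5).
Notation rvy := (PR 6).     Notation rvz := (PR 7).
Notation rvvx := (PR 8).    Notation rout := (PR 9).
Notation rtgt := (PR 10).   Notation rres := (PR 11).
Notation rnpc := (PR 12).   Notation rnout := (PR 13).
Notation raux n := (PR (14 + n)).
Notation cV := (PV 0).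

(** * Gadgets: conditions that describe single operations *)

Definition gadget_const (c : Mconst) : pexp :=
  match c with
  | Czero => rres == PC 0
  | Cone => rres == PC 1
  | Cminus_one => rres + PC 1 == gW
  | Cn => rres == gm
  end%P.

Definition gadget_pow_base (x w w' h : pexp) : pexp :=
  ((w * w' == gQE) && (w == PC 1 + x * gQ1 + h * (gQ1 * gQ1)))%P.

(** For [x < m], the auxiliary values 0 and 1 are the two digits [xh] and [xl] of [x] in base [E]; 2
    to 4 and 5 to 7 are the powers of [Q] with these exponents, each followed by its cofactor in
    [Q ^ E] and its second order term; 8 and 9 are remainder and quotient modulo [Q - 2]. That
    [xh < E] follows from [x < m <= E * E]. *)
Definition gadget_pow : pexp :=
  ((gm <= rvx) && (rres + PC 1 == gW) ||
   (rvx < gm) && (rvx == raux 0 * gE + raux 1) && (raux 1 < gE) &&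
   gadget_pow_base (raux 0) (raux 2) (raux 3) (raux 4) &&
   gadget_pow_base (raux 1) (raux 5) (raux 6) (raux 7) &&
   (raux 5 == raux 9 * gQ2 + raux 8) && (raux 8 < gQ2) && (rres == raux 2 * raux 8))%P.

Definition gadget_unop (f : Munop) : pexp :=
  match f with
  | Ucompl => (rres + rvx + PC 1 == gW)%P
  | Upow => gadget_pow
  end.

Definition gadget_binop (f : Mbinop) : pexp :=
  match f with
  | Badd => (rvx + rvy == raux 0 * gW + rres) && (rres < gW)
  | Bmul => (rvx * rvy == raux 0 * gW + rres) && (rres < gW)
  | Bdiv => (rvy == PC 0) && (rres == PC 0) ||
            (rvx == rres * rvy + raux 0) && (raux 0 < rvy)
  | Bmax => (rvx <= rvy) && (rres == rvy) || (rvy <= rvx) && (rres == rvx)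
  | Bmin => (rvx <= rvy) && (rres == rvx) || (rvy <= rvx) && (rres == rvy)
  | Bcap => rres == PCap rvx rvy
  end%P.

Definition next_pc : pexp := (rnpc == rpc + PC 4)%P.
Definition keep_out : pexp := (rnout == rout)%P.
(** No column has the address [A]. *)
Definition no_write : pexp := (rtgt == gA)%P.
Definition set_z (c : pexp) : pexp := ((rtgt == rz) && next_pc && keep_out && c)%P.

(** A cell outside the tableau has no column to be compared with, and its guessed content would be
    free; hence every address that is read must be below [A]. A write outside the tableau is
    harmless, since it changes no recorded cell. [OInput] delivers 0 because the input tape is
    empty. *)
Definition gadget_op (o : opcode) : pexp :=
  match o with
  | OHalt => no_write && (rnpc == rpc) && keep_out
  | OConst c => set_z (gadget_const c)
  | OUn f => (rx < gA) && set_z (gadget_unop f)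
  | OBin f => (rx < gA) && (ry < gA) && set_z (gadget_binop f)
  | ORead => (rx < gA) && (rvx < gA) && set_z (rres == rvvx)
  | OWrite => (rx < gA) && (rz < gA) && (rtgt == rvz) && (rres == rvx) && next_pc && keep_out
  | OJump => no_write && keep_out && (rnpc == rz)
  | OJumpEq => (rx < gA) && (ry < gA) && no_write && keep_out &&
      ((rvx == rvy) && (rnpc == rz) || PNot (rvx == rvy) && next_pc)
  | OJumpLe => (rx < gA) && (ry < gA) && no_write && keep_out &&
      ((rvx <= rvy) && (rnpc == rz) || PNot (rvx <= rvy) && next_pc)
  | OInput => set_z (rres == PC 0)
  | OOutput => (rx < gA) && no_write && next_pc && (rnout == rvx)
  end%P.

(** [m <= E * E] makes both digits of an exponent below [m] smaller than [E], and [E * E <= 2 * m]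
    keeps [Q ^ E = 2 ^ (E * E)] within a digit. *)
Record machine_params (m E A : nat) (gv : nat -> nat) : Prop := MachineParams {
  par_A : gv 0 = A;
  par_W : gv 1 = 2 ^ m;
  par_m : gv 2 = m;
  par_E : gv 4 = E;
  par_Q1 : gv 5 = 2 ^ E - 1;
  par_Q2 : gv 6 = 2 ^ E - 2;
  par_QE : gv 7 = 2 ^ (E * E);
  par_E_gt2 : 2 < E;
  par_m_le : m <= E * E;
  par_m_ge : E * E <= 2 * m;
  par_A_lt : A < 2 ^ m }.

Section Gadgets.
Variables (m E A : nat) (gv : nat -> nat).
Hypothesis par : machine_params m E A gv.

Let gv_A := par_A par.
Let gv_W := par_W par.
Let gv_m := par_m par.
Let gv_E := par_E par.
Let gv_Q1 := par_Q1 par.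
Let gv_Q2 := par_Q2 par.
Let gv_QE := par_QE par.
Let E_gt2 := par_E_gt2 par.
Let m_le := par_m_le par.
Let m_ge := par_m_ge par.
Let A_lt := par_A_lt par.

Local Notation holds vc vr p i a := (holds vc vr gv A p i a).
Local Notation D := (2 ^ (4 * m)).

Let m_gt0 : 0 < m. Proof. nia. Qed.
Let m_lt : m < 2 ^ m. Proof. exact: ltn_expl. Qed.

Lemma word_lt (x : word m) : x < 2 ^ m. Proof. exact: ltn_ord. Qed.

Let lt_D x : x <= 2 ^ (2 * m) -> x < D.
Proof. move=> le; apply: leq_ltn_trans le _; rewrite ltn_exp2l //; lia. Qed.

Let word_leD x : x < 2 ^ m -> x < D.
Proof. by move=> /ltnW le; apply/lt_D/(leq_trans le); rewrite leq_exp2l //; lia. Qed.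

Let gvE := (gv_A, gv_W, gv_m, gv_E, gv_Q1, gv_Q2, gv_QE).

Lemma gadget_constP c vc (vr : nat -> nat -> nat) i a :
  holds vc vr (gadget_const c) i a = (vr 11 i == const_sem m c).
Proof.
case: c; rewrite !holdsE /= ?gvE ?mod0n // ?modn_small //; try lia.
Qed.

Let Eq : (2 ^ E - 1).+1 = 2 ^ E.
Proof. by rewrite subn1 prednK // expn_gt0. Qed.

Lemma pow_base_sound x w w' h : w * w' = 2 ^ (E * E) ->
  w = 1 + x * (2 ^ E - 1) + h * ((2 ^ E - 1) * (2 ^ E - 1)) -> x < E -> w = (2 ^ E) ^ x.
Proof.
move=> Ew E1 lt_x; rewrite -Eq; apply: power_recognition E1 lt_x => //; first by lia.
by rewrite -Ew dvdn_mulr.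
Qed.

Lemma pow_base_complete x : x < E -> let w := (2 ^ E) ^ x in
  exists w' h, [/\ w < D, w' < D, h < D, w * w' = 2 ^ (E * E) &
    w = 1 + x * (2 ^ E - 1) + h * ((2 ^ E - 1) * (2 ^ E - 1))].
Proof.
move=> lt_x w; have [h Eh] := expn_mod_sqr (2 ^ E - 1) x; rewrite Eq -/w in Eh.
have wD y : y <= E -> (2 ^ E) ^ y <= 2 ^ (2 * m).
  by move=> le; rewrite -expnM leq_exp2l //; apply: leq_trans m_ge; rewrite leq_mul2l le orbT.
exists ((2 ^ E) ^ (E - x)), h; split=> //.
- by apply/lt_D/wD; lia.
- by apply/lt_D/wD; lia.
- apply/lt_D; apply: leq_trans (wD x _); last by lia.
  rewrite -/w Eh; have : 4 <= 2 ^ E by rewrite (@leq_pexp2l 2 2) //; lia.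
  (* [h] is at most [h * q ^ 2], hence at most the power itself. *)
  by move=> ge4; apply: leq_trans (leq_addl _ _); rewrite leq_pmulr // muln_gt0; lia.
by rewrite /w -expnD subnKC ?expnM //; lia.
Qed.

Lemma gadget_unop_sound f vc (vr : nat -> nat -> nat) i a (x : word m) : vr 5 i = x ->
  holds vc vr (gadget_unop f) i a -> vr 11 i = unop_sem f x.
Proof.
rewrite /unop_sem val_to_word; case: f => Ex.
  rewrite !holdsE /= Ex gv_W => /eqP Er.
  have := sum_bits_compl (word_lt x); have := word_lt x.
  by move: (\sum_(j < m) _) => u lt Es; rewrite modn_small; lia.
rewrite /gadget_unop /gadget_pow /gadget_pow_base !holdsE /= Ex !gvE => /orP[/andP[le_m /eqP Er]|].
  rewrite (minn_idPr _); last by apply: leq_trans (leq_subr _ _) _; rewrite leq_exp2l.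
  by rewrite modn_small; lia.
move=> /andP[/andP[/andP[/andP[/andP[/andP[/andP[lt_m /eqP E0] lt1] /andP[/eqP Ea /eqP Eb]]]]]].
move=> /andP[/eqP Ec /eqP Ed] /eqP Ee lt8 /eqP ->.
have lt0 : vr (14 + 0) i < E by rewrite -(@ltn_pmul2r E); lia.
rewrite (pow_base_sound Ea Eb lt0); have E5 := pow_base_sound Ec Ed lt1.
have := expn_mod_sub2 E_gt2 lt1; rewrite -E5 Ee modnMDl modn_small // => ->.
have ltx : 2 ^ x < 2 ^ m by rewrite ltn_exp2l.
rewrite -expnM -expnD (_ : E * _ + _ = x); last by rewrite E0 mulnC.
by rewrite (minn_idPl _) ?modn_small //; lia.
Qed.

(** The auxiliary values depend on the operand alone. Choosing them before the valuations allows the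
    guesses to be fixed row by row and only then assembled into row variables. *)
Lemma gadget_unop_complete f (x : word m) : exists2 aux, all (fun n => n < D) aux &
  forall vc (vr : nat -> nat -> nat) i a, vr 5 i = x -> vr 11 i = unop_sem f x ->
  (forall n, vr (14 + n) i = nth 0 aux n) -> holds vc vr (gadget_unop f) i a.
Proof.
rewrite /unop_sem val_to_word; case: f.
  exists [::] => // vc vr i a Ex Er _; rewrite !holdsE /= Ex Er gv_W /=.
  have := sum_bits_compl (word_lt x); have := word_lt x.
  by move: (\sum_(j < m) _) => u lt Es; rewrite modn_small; lia.
have [le_m|lt_m] := leqP m x.
  exists [::] => // vc vr i a Ex Er _; rewrite !holdsE /= Ex Er !gvE le_m /=.
  rewrite (minn_idPr _); last by apply: leq_trans (leq_subr _ _) _; rewrite leq_exp2l.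
  by rewrite modn_small; lia.
pose xh := x %/ E; pose xl := x %% E.
have E_gt0 : 0 < E by lia.
have lt_xl : xl < E by rewrite ltn_mod.
have lt_xh : xh < E by rewrite ltn_divLR //; lia.
have Exx : nat_of_ord x = xh * E + xl := divn_eq x E.
have [wh' [hh [wh_lt wh'_lt hh_lt Ewh Ehh]]] := pow_base_complete lt_xh.
have [wl' [hl [wl_lt wl'_lt hl_lt Ewl Ehl]]] := pow_base_complete lt_xl.
have E_lt : E < 2 ^ E by apply: ltn_expl.
pose g := (2 ^ E) ^ xl %/ (2 ^ E - 2).
exists [:: xh; xl; (2 ^ E) ^ xh; wh'; hh; (2 ^ E) ^ xl; wl'; hl; 2 ^ xl; g].
  rewrite /= wh_lt wh'_lt hh_lt wl_lt wl'_lt hl_lt (leq_ltn_trans (leq_div _ _) wl_lt) !andbT.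
  have leE : E <= E * E by rewrite leq_pmulr.
  have D2 : E < D by apply: ltn_trans E_lt _; rewrite ltn_exp2l //; lia.
  rewrite (ltn_trans lt_xh D2) (ltn_trans lt_xl D2) /=.
  by apply: leq_ltn_trans wl_lt; rewrite -expnM leq_exp2l // leq_pmull.
move=> vc vr i a Ex Er aux.
rewrite /gadget_unop /gadget_pow /gadget_pow_base !holdsE /= !aux /= Ex Er !gvE.
apply/orP; right; rewrite lt_m -Exx lt_xl Ewh Ewl -Ehh -Ehl !eqxx /=.
have Em := expn_mod_sub2 E_gt2 lt_xl.
have := divn_eq ((2 ^ E) ^ xl) (2 ^ E - 2); rewrite Em -/g => <-; rewrite eqxx /=.
rewrite -{1}Em ltn_mod; have -> /= : 0 < 2 ^ E - 2 by lia.
have ltx : 2 ^ x < 2 ^ m by rewrite ltn_exp2l.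
rewrite -expnM -expnD (mulnC E) -Exx.
by rewrite (minn_idPl _) ?modn_small //; lia.
Qed.

Lemma gadget_binop_sound f vc (vr : nat -> nat -> nat) i a (x y : word m) : vr 5 i = x -> vr 6 i = y ->
  holds vc vr (gadget_binop f) i a -> vr 11 i = binop_sem f x y.
Proof.
move=> Ex Ey; have := word_lt x; have := word_lt y => lt_y lt_x.
rewrite /binop_sem val_to_word; case: f; rewrite !holdsE /= ?gvE Ex Ey.
- by move=> /andP[/eqP -> lt_r]; rewrite modnMDl modn_small.
- by move=> /andP[/eqP -> lt_r]; rewrite modnMDl modn_small.
- rewrite (modn_small (leq_ltn_trans (leq_div _ _) lt_x)).
  case/orP => /andP[/eqP E1]; first by rewrite E1 divn0 => /eqP.
  by move=> lt_r; rewrite {1}E1 divnMDl ?divn_small ?addn0 //; lia.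
- by rewrite modn_small; lia.
- by rewrite modn_small; lia.
by rewrite sum_bits_capn // modn_small ?capn_lt // => /eqP.
Qed.

Lemma gadget_binop_complete f (x y : word m) : exists2 aux, all (fun n => n < D) aux &
  forall vc (vr : nat -> nat -> nat) i a, vr 5 i = x -> vr 6 i = y -> vr 11 i = binop_sem f x y ->
  (forall n, vr (14 + n) i = nth 0 aux n) -> holds vc vr (gadget_binop f) i a.
Proof.
have := word_lt x; have := word_lt y => lt_y lt_x.
have W_gt0 : 0 < 2 ^ m by rewrite expn_gt0.
have W_gt1 : 1 < 2 ^ m by lia.
have lt_xy : x * y < D.
  by apply: lt_D; rewrite mul2n -addnn expnD leq_mul // ltnW.
exists [:: match f with Badd => (x + y) %/ 2 ^ m | Bmul => (x * y) %/ 2 ^ m | _ => x %% y end].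
  rewrite /= andbT; case: f; try exact: leq_ltn_trans (leq_mod _ _) (word_leD lt_x).
    by apply: leq_ltn_trans (leq_div _ _) _; apply: lt_D; rewrite mul2n -addnn expnD; nia.
  by apply: leq_ltn_trans (leq_div _ _) lt_xy.
rewrite /binop_sem val_to_word => vc vr i a Ex Ey Er aux.
case: f Er aux => /= Er aux; rewrite !holdsE /= ?gvE Ex Ey Er ?(aux 0) /=.
- by rewrite -divn_eq eqxx ltn_mod.
- by rewrite -divn_eq eqxx ltn_mod.
- rewrite (modn_small (leq_ltn_trans (leq_div _ _) lt_x)) -divn_eq eqxx ltn_mod.
  by case: (posnP y) => // ->; rewrite divn0.
- by rewrite modn_small; lia.
- by rewrite modn_small; lia.
by rewrite sum_bits_capn // modn_small ?capn_lt.
Qed.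

End Gadgets.

Definition PAll (ps : seq pexp) : pexp := foldr PAnd (PC 1) ps.

Lemma holds_all vc vr gv A ps i a :
  holds vc vr gv A (PAll ps) i a = all (fun p => holds vc vr gv A p i a) ps.
Proof. by elim: ps => //= p ps <-; rewrite holds_and. Qed.

(** There are 20 opcodes, and every larger code halts; the finite case distinction on the guessed
    code is thus complete. *)
Definition gadget_step : pexp :=
  (PAll [seq (rop == PC c ~> gadget_op (nth OHalt opcodes c))%P | c <- iota 0 20] &&
   (PC 20 <= rop ~> gadget_op OHalt))%P.

Lemma gadget_stepP vc vr gv A i a : holds vc vr gv A gadget_step i a
  = holds vc vr gv A (gadget_op (nth OHalt opcodes (vr 1 i))) i a.
Proof.
rewrite holds_and holds_imp holds_le holds_all all_map.
rewrite -[peval _ _ _ _ rop i a]/(vr 1 i) -[peval _ _ _ _ (PC 20) i a]/20.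
have [lt|ge] := ltnP (vr 1 i) 20; last first.
  rewrite (@nth_default _ _ opcodes _ ge) andb_idl // => _.
  by apply/allP => c; rewrite mem_iota => /andP[_ lt_c] /=; rewrite !holdsE /= gtn_eqF //; lia.
rewrite andbT; apply/allP/idP => [all_c | ok c].
  have := all_c (vr 1 i); rewrite mem_iota lt /= holds_imp holds_eq /= eqxx; exact.
by rewrite mem_iota => _ /=; rewrite holds_imp holds_eq /=; apply/implyP => /eqP <-.
Qed.

Lemma nth_opcodes_halt n : (if nth OHalt opcodes n is OHalt then true else false)
  = (n == 0) || (20 <= n).
Proof. by do 20! case: n => [//|n]; rewrite nth_default. Qed.

(** [PNext (PC 1)] is positive except in the last row. That row must be halted with output [gb]; a
    run that halts earlier fills the remaining rows, since a halted configuration is its own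
    successor. *)
Definition tableau (cells : seq pexp) : pexp :=
  PAll [::
    (PFirst ~> (rpc == PC 0) && (rout == PC 0) && (PC (size cells) <= PAdr ~> cV == PC 0) &&
       PAll [seq PAdr == PC c ~> cV == nth (PC 0) cells c | c <- iota 0 (size cells)])%P;
    (rpc + PC 3 < gA)%P;
    (PAdr == rpc ~> cV == rop)%P;
    (PAdr == rpc + PC 1 ~> cV == rx)%P;
    (PAdr == rpc + PC 2 ~> cV == ry)%P;
    (PAdr == rpc + PC 3 ~> cV == rz)%P;
    (PAdr == rx ~> cV == rvx)%P;
    (PAdr == ry ~> cV == rvy)%P;
    (PAdr == rz ~> cV == rvz)%P;
    (PAdr == rvx ~> cV == rvvx)%P;
    gadget_step;
    (PNext (PC 1) ~> (PNext rpc == rnpc) && (PNext rout == rnout) &&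
      (PAdr == rtgt ~> PNext cV == rres) && (PNot (PAdr == rtgt) ~> PNext cV == cV))%P;
    (PNot (PNext (PC 1)) ~> ((rop == PC 0) || (PC 20 <= rop)) && (rout == gb))%P ].

(** * Correctness of a single row *)

Section Simulation.
Variables (m E A : nat) (gv : nat -> nat).
Hypothesis par : machine_params m E A gv.

Let gv_A := par_A par.
Let A_lt := par_A_lt par.

Local Notation holds vc vr p i a := (holds vc vr gv A p i a).
Local Notation D := (2 ^ (4 * m)).

Let next_val (s : config m) i : i <= 4 -> pc s + 3 < A -> nat_of_ord (fetch_addr s i) = pc s + i.
Proof. by move=> le lt; rewrite to_wordE //; lia. Qed.

(** Guessed contents are known to be faithful only at addresses below [A], so the hypotheses about
    them are conditional; the gadget itself asserts the bounds that discharge the conditions. *)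
Lemma gadget_op_sound vc (vr : nat -> nat -> nat) i a (s : config m) :
  intape s = [::] -> pc s + 3 < A ->
  vr 0 i = pc s -> vr 2 i = fetch s 1 -> vr 3 i = fetch s 2 -> vr 4 i = fetch s 3 ->
  vr 9 i = outreg s ->
  (fetch s 1 < A -> vr 5 i = mem s (fetch s 1)) ->
  (fetch s 2 < A -> vr 6 i = mem s (fetch s 2)) ->
  (fetch s 3 < A -> vr 7 i = mem s (fetch s 3)) ->
  (fetch s 1 < A -> mem s (fetch s 1) < A -> vr 8 i = mem s (mem s (fetch s 1))) ->
  holds vc vr (gadget_op (current_op s)) i a ->
  [/\ vr 12 i = pc (step s), vr 13 i = outreg (step s), intape (step s) = [::] &
      forall c : word m, c < A ->
        nat_of_ord (mem (step s) c) = if nat_of_ord c == vr 10 i then vr 11 i else mem s c].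
Proof.
move=> Et lt_pc E0 E2 E3 E4 E9 E5 E6 E7 E8; rewrite /step.
have n4 : (pc s + 4) %% 2 ^ m = pc s + 4 := next_val (leqnn 4) lt_pc.
have nowr (c : word m) (f : word m -> word m) (u v : nat) : u = A -> c < A ->
    nat_of_ord (f c) = if nat_of_ord c == u then v else f c.
  by move=> -> lt_c; rewrite ltn_eqF.
have updE (f : word m -> word m) z w c : nat_of_ord (upd f z w c) =
    if nat_of_ord c == z then nat_of_ord w else f c.
  by rewrite /upd -val_eqE; case: ifP.
case: (current_op s) => [|k|f|f||||||| ]; rewrite /gadget_op /set_z /no_write /next_pc /keep_out.
- rewrite !holdsE /= E0 E9 gv_A => /andP[/andP[/eqP tA /eqP Ep] /eqP Eo]; split=> // c.
  exact: nowr.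
- rewrite !holds_and (gadget_constP par) !holdsE /= E0 E4 E9.
  move=> /andP[/andP[/andP[/eqP tz /eqP Ep] /eqP Eo] /eqP Er].
  by split=> // [|c lt_c]; rewrite ?n4 // updE tz Er.
- rewrite !holds_and => /andP[]; rewrite holds_lt /= gv_A E2 => /[dup] ltx /E5 {}E5.
  move=> /andP[cond /(gadget_unop_sound par E5) Er].
  move: cond; rewrite !holdsE /= E0 E4 E9 => /andP[/andP[/eqP tz /eqP Ep] /eqP Eo].
  by split=> // [|c lt_c]; rewrite ?n4 // updE tz Er.
- rewrite !holds_and => /andP[]; rewrite !holds_lt /= gv_A E2 E3.
  move=> /andP[/E5 {}E5 /E6 {}E6] /andP[cond].
  move=> /(gadget_binop_sound par E5 E6) Er.
  move: cond; rewrite !holdsE /= E0 E4 E9 => /andP[/andP[/eqP tz /eqP Ep] /eqP Eo].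
  by split=> // [|c lt_c]; rewrite ?n4 // updE tz Er.
- rewrite !holdsE /= gv_A E0 E2 E4 E9 => /andP[/andP[/[dup] ltx /E5 {}E5]]; rewrite E5.
  move=> /(E8 ltx) {}E8 /andP[/andP[/andP[/eqP tz /eqP Ep] /eqP Eo] /eqP Er].
  by split=> // [|c lt_c]; rewrite ?n4 // updE tz Er E8.
- rewrite !holdsE /= gv_A E0 E2 E4 E9.
  move=> /andP[/andP[/andP[/andP[/andP[/E5 {}E5 /E7 {}E7] /eqP tz] /eqP Er] /eqP Ep] /eqP Eo].
  by split=> // [|c lt_c]; rewrite ?n4 // updE tz Er E7 E5.
- rewrite !holdsE /= gv_A E4 E9 => /andP[/andP[/eqP tA /eqP Eo] /eqP Ep]; split=> // c.
  exact: nowr.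
- rewrite !holdsE /= gv_A E0 E2 E3 E4 E9.
  move=> /andP[/andP[/andP[/andP[/E5 -> /E6 ->] /eqP tA] /eqP Eo] jmp].
  split=> //; last by move=> c; apply: nowr.
  rewrite -val_eqE /=; case: eqP jmp => /= _; rewrite ?orbF => /eqP -> //.
- rewrite !holdsE /= gv_A E0 E2 E3 E4 E9.
  move=> /andP[/andP[/andP[/andP[/E5 -> /E6 ->] /eqP tA] /eqP Eo] jmp].
  split=> //; last by move=> c; apply: nowr.
  by case: (_ <= _) jmp => /=; rewrite ?orbF => /eqP ->.
- rewrite !holdsE /= E0 E4 E9 Et /= => /andP[/andP[/andP[/eqP tz /eqP Ep] /eqP Eo] /eqP Er].
  by split=> // [|c lt_c]; rewrite ?n4 // updE tz Er /= mod0n.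
rewrite !holdsE /= gv_A E0 E2 => /andP[/andP[/andP[/E5 -> /eqP tA] /eqP Ep] /eqP Eo].
by split=> // [|c]; [rewrite n4 | apply: nowr].
Qed.

Definition target (s : config m) : nat :=
  match current_op s with
  | OConst _ | OUn _ | OBin _ | ORead | OInput => fetch s 3
  | OWrite => mem s (fetch s 3)
  | _ => A
  end.

(** Listed in the order of the row variables 0 to 13; the auxiliary values of the gadget follow from
    14 on. *)
Definition registers (s : config m) : seq nat :=
  [:: pc s : nat; fetch s 0 : nat; fetch s 1 : nat; fetch s 2 : nat; fetch s 3 : nat;
      mem s (fetch s 1) : nat; mem s (fetch s 2) : nat; mem s (fetch s 3) : nat;
      mem s (mem s (fetch s 1)) : nat; outreg s : nat;
      target s; mem (step s) (to_word m (target s)) : nat;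
      pc (step s) : nat; outreg (step s) : nat].

Lemma gadget_op_complete (s : config m) (S : nat) : intape s = [::] -> S + 3 <= A ->
  all (fun c : word m => c < S) (accessed s) ->
  exists2 aux, all (fun n => n < D) aux &
    forall vc (vr : nat -> nat -> nat) i a,
      (forall n, vr n i = nth 0 (registers s ++ aux) n) ->
      holds vc vr (gadget_op (current_op s)) i a.
Proof.
move=> Et leSA; rewrite /accessed all_cat => /andP[/= /andP[lt_pc _]].
(* The three spare columns yield [pc s + 3 < A], so the whole instruction is in the tableau and
   [pc s + 4] does not wrap around. *)
have {}lt_pc : pc s < S by move: lt_pc; rewrite addn0 modn_small.
have n4 : (pc s + 4) %% 2 ^ m = pc s + 4 by apply: next_val => //; lia.
have lt_A x : x < S -> x < A by lia.
have updE (f : word m -> word m) z w : upd f z w (to_word m z) = w.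
  by rewrite /upd to_wordK eqxx.
rewrite /registers /target /step.
case: (current_op s) => [|k|f|f||||||| ] /=; rewrite /set_z /no_write /next_pc /keep_out.
- by exists [::] => // vc vr i a Ev; rewrite !holdsE /= !Ev /= gv_A !eqxx.
- exists [::] => // vc vr i a Ev; rewrite !holds_and (gadget_constP par) !holdsE /= !Ev /=.
  by rewrite n4 updE !eqxx.
- move=> /andP[/lt_A ltx _].
  have [aux auxD aux_ok] := gadget_unop_complete par f (mem s (fetch s 1)).
  exists aux => // vc vr i a Ev; rewrite !holds_and aux_ok ?Ev ?updE //.
  by rewrite !holdsE /= !Ev /= n4 !eqxx gv_A ltx.
- move=> /and4P[/lt_A ltx /lt_A lty _ _].
  have [aux auxD aux_ok] := gadget_binop_complete par f (mem s (fetch s 1)) (mem s (fetch s 2)).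
  exists aux => // vc vr i a Ev; rewrite !holds_and aux_ok ?Ev ?updE //.
  by rewrite !holdsE /= !Ev /= n4 !eqxx gv_A ltx lty.
- move=> /and4P[/lt_A ltx /lt_A lty _ _]; exists [::] => // vc vr i a Ev.
  by rewrite !holdsE /= !Ev /= n4 updE !eqxx gv_A ltx lty.
- move=> /and4P[/lt_A ltx /lt_A ltz _ _]; exists [::] => // vc vr i a Ev.
  by rewrite !holdsE /= !Ev /= n4 updE !eqxx gv_A ltx ltz.
- by exists [::] => // vc vr i a Ev; rewrite !holdsE /= !Ev /= gv_A !eqxx.
- move=> /and3P[/lt_A ltx /lt_A lty _]; exists [::] => // vc vr i a Ev.
  rewrite !holdsE /= !Ev /= gv_A !eqxx ltx lty /= -val_eqE /=.
  by case: eqP; rewrite /= ?n4 eqxx.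
- move=> /and3P[/lt_A ltx /lt_A lty _]; exists [::] => // vc vr i a Ev.
  rewrite !holdsE /= !Ev /= gv_A !eqxx ltx lty /=.
  by case: (_ <= _); rewrite /= ?n4 eqxx.
- move=> _; exists [::] => // vc vr i a Ev; rewrite !holdsE /= !Ev /= n4 updE Et.
  by rewrite !eqxx /= mod0n.
move=> /andP[/lt_A ltx _]; exists [::] => // vc vr i a Ev.
by rewrite !holdsE /= !Ev /= gv_A ltx n4 !eqxx.
Qed.

End Simulation.

(** Finite choice by induction, which collects the auxiliary lists of all rows into one function
    without an axiom. *)
Lemma bounded_choice (T : Type) (x0 : T) (P : nat -> T -> Prop) n :
  (forall i, i < n -> exists x, P i x) -> exists f, forall i, i < n -> P i (f i).
Proof.
elim: n => [|n IH] ex; first by exists (fun=> x0).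
have [f fP] := IH (fun i lt => ex i (ltnW lt)); have [x Px] := ex n (ltnSn n).
exists (fun i => if i == n then x else f i) => i; rewrite ltnS leq_eqVlt.
by case: eqP => [->|_ /fP].
Qed.

(** * Correctness of the whole tableau *)

Section Tableau.
Variables (m E A : nat) (gv : nat -> nat).
Hypothesis par : machine_params m E A gv.
Variables (cells : seq pexp) (l : seq nat).
Hypothesis size_cells : size cells = size l.
Hypothesis l_lt : forall c, nth 0 l c < 2 ^ m.
Hypothesis cellsE : forall vc vr i a c,
  peval vc vr gv A (nth (PC 0) cells c) i a = nth 0 l c.

Let gv_A := par_A par.
Let A_lt := par_A_lt par.
Local Notation holds vc vr p i a := (holds vc vr gv A p i a).
Local Notation D := (2 ^ (4 * m)).
Local Notation s i := (iter i (@step m) (init_config m l)).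

Lemma tableauE vc (vr : nat -> nat -> nat) i a : holds vc vr (tableau cells) i a =
  [&& (i == 0) ==> [&& vr 0 i == 0, vr 9 i == 0 & vc 0 i a == nth 0 l a],
      vr 0 i + 3 < A,
      (a == vr 0 i) ==> (vc 0 i a == vr 1 i),
      (a == vr 0 i + 1) ==> (vc 0 i a == vr 2 i),
      (a == vr 0 i + 2) ==> (vc 0 i a == vr 3 i),
      (a == vr 0 i + 3) ==> (vc 0 i a == vr 4 i),
      (a == vr 2 i) ==> (vc 0 i a == vr 5 i),
      (a == vr 3 i) ==> (vc 0 i a == vr 6 i),
      (a == vr 4 i) ==> (vc 0 i a == vr 7 i),
      (a == vr 5 i) ==> (vc 0 i a == vr 8 i),
      holds vc vr (gadget_op (nth OHalt opcodes (vr 1 i))) i a,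
      (i.+1 < A) ==> [&& vr 0 i.+1 == vr 12 i, vr 9 i.+1 == vr 13 i
                       & vc 0 i.+1 a == if a == vr 10 i then vr 11 i else vc 0 i a]
    & ~~ (i.+1 < A) ==> ((vr 1 i == 0) || (20 <= vr 1 i)) && (vr 9 i == gv 3)].
Proof.
have init : holds vc vr (PAll [seq (PAdr == PC c ~> cV == nth (PC 0) cells c)%P | c <- iota 0 (size cells)]) i a
   && ((size cells <= a) ==> (vc 0 i a == 0)) = (vc 0 i a == nth 0 l a).
  rewrite holds_all all_map; have [ge|lt] := leqP (size cells) a.
    rewrite (@nth_default _ 0 l) -?size_cells //= andb_idl // => _.
    apply/allP => c; rewrite mem_iota => /andP[_ lt_c] /=; rewrite !holdsE /= gtn_eqF //.
    exact: leq_trans lt_c ge.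
  rewrite andbT; apply/allP/idP => [/(_ a)|ok c _ /=].
    by rewrite mem_iota lt /= !holdsE /= cellsE eqxx; apply.
  by rewrite !holdsE /= cellsE; apply/implyP => /eqP <-.
have PN p : peval vc vr gv A (PNext p) i a = if i.+1 < A then peval vc vr gv A p i.+1 a else 0 by [].
have next1 : holds vc vr (PNext (PC 1)) i a = (i.+1 < A) by rewrite holds_next andbT.
rewrite /tableau holds_all -init [all _ _]/= gadget_stepP !holdsE.
rewrite next1 !PN.
rewrite holds_first.
congr (_ && _); first by rewrite -!andbA [X in [&& _, _ & X]]andbC.
congr (_ && _); first by rewrite -gv_A.
do 9! (congr (_ && _)); congr (_ && _); last by rewrite andbT.
by case: (i.+1 < A) => //=; rewrite -!andbA; case: (a == vr 10 i); rewrite ?andbT.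
Qed.

Lemma tableau_sound vc vr : 0 < A ->
  (forall i a, i < A -> a < A -> holds vc vr (tableau cells) i a) ->
  halted (s A.-1) /\ nat_of_ord (outreg (s A.-1)) = gv 3.
Proof.
move=> A_gt0 tab.
(* If program counter, output and cells of a row agree with the machine, then the row is forced to
   guess the right instruction and operands, and it describes the right successor. *)
have row i : i < A -> [/\ vr 0 i = pc (s i), vr 9 i = outreg (s i), intape (s i) = [::] &
    forall c : word m, c < A -> vc 0 i c = mem (s i) c] ->
    [/\ nth OHalt opcodes (vr 1 i) = current_op (s i), vr 1 i = fetch (s i) 0 &
     [/\ vr 12 i = pc (step (s i)), vr 13 i = outreg (step (s i)), intape (step (s i)) = [::] &
      forall c : word m, c < A -> nat_of_ord (mem (step (s i)) c) =
        if nat_of_ord c == vr 10 i then vr 11 i else vc 0 i c]].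
  move=> lt_i [Epc Eout Et Emem].
  have := tab i 0 lt_i A_gt0; rewrite tableauE => /and3P[_ lt_pc _].
  have lt_pc' : pc (s i) + 3 < A by rewrite -Epc.
  have fa j : j <= 3 -> nat_of_ord (fetch_addr (s i) j) = vr 0 i + j.
    by move=> le_j; rewrite Epc to_wordE //; lia.
  (* The column with address [pc + j] exists because [pc + 3 < A]; the condition at this very column
     forces the guess. *)
  have fetchE j x : j <= 3 ->
      (forall a, a < A -> a = vr 0 i + j -> vc 0 i a = x) -> x = fetch (s i) j.
    move=> le_j H; rewrite /fetch -Emem fa //; last by lia.
    by rewrite (H _ _ (erefl _)) //; lia.
  have E1 : vr 1 i = fetch (s i) 0.
    apply: fetchE => // a lt_a; rewrite addn0 => Ea.
    have := tab i a lt_i lt_a; rewrite tableauE => /and4P[_ _ /implyP H _].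
    by apply/eqP/H/eqP.
  have E2 : vr 2 i = fetch (s i) 1.
    apply: fetchE => // a lt_a Ea; have := tab i a lt_i lt_a.
    by rewrite tableauE => /and5P[_ _ _ /implyP H _]; apply/eqP/H/eqP.
  have E3 : vr 3 i = fetch (s i) 2.
    apply: fetchE => // a lt_a Ea; have := tab i a lt_i lt_a.
    by rewrite tableauE => /and5P[_ _ _ _ /andP[/implyP H _]]; apply/eqP/H/eqP.
  have E4 : vr 4 i = fetch (s i) 3.
    apply: fetchE => // a lt_a Ea; have := tab i a lt_i lt_a.
    by rewrite tableauE => /and5P[_ _ _ _ /and3P[_ /implyP H _]]; apply/eqP/H/eqP.
  have valE (c : word m) x : c < A ->
      (forall a, a < A -> a = c -> vc 0 i a = x) -> x = mem (s i) c.
    by move=> lt_c H; rewrite -Emem // (H _ _ (erefl _)).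
  have E5 : fetch (s i) 1 < A -> vr 5 i = mem (s i) (fetch (s i) 1).
    move=> lt; apply: valE => // a lt_a; rewrite -E2 => Ea; have := tab i a lt_i lt_a.
    by rewrite tableauE => /and5P[_ _ _ _ /and4P[_ _ /implyP H _]]; apply/eqP/H/eqP.
  have E6 : fetch (s i) 2 < A -> vr 6 i = mem (s i) (fetch (s i) 2).
    move=> lt; apply: valE => // a lt_a; rewrite -E3 => Ea; have := tab i a lt_i lt_a.
    by rewrite tableauE => /and5P[_ _ _ _ /and5P[_ _ _ /implyP H _]]; apply/eqP/H/eqP.
  have E7 : fetch (s i) 3 < A -> vr 7 i = mem (s i) (fetch (s i) 3).
    move=> lt; apply: valE => // a lt_a; rewrite -E4 => Ea; have := tab i a lt_i lt_a.
    by rewrite tableauE => /and5P[_ _ _ _ /and5P[_ _ _ _ /andP[/implyP H _]]]; apply/eqP/H/eqP.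
  have E8 : fetch (s i) 1 < A -> mem (s i) (fetch (s i) 1) < A ->
      vr 8 i = mem (s i) (mem (s i) (fetch (s i) 1)).
    move=> lt lt2; apply: valE => // a lt_a; rewrite -E5 // => Ea; have := tab i a lt_i lt_a.
    by rewrite tableauE => /and5P[_ _ _ _ /and5P[_ _ _ _ /and3P[_ /implyP H _]]]; apply/eqP/H/eqP.
  have Eop : nth OHalt opcodes (vr 1 i) = current_op (s i) by rewrite E1.
  split=> //.
  have := tab i 0 lt_i A_gt0; rewrite tableauE => /and5P[_ _ _ _ /and5P[_ _ _ _ /and4P[_ _ op _]]].
  rewrite Eop in op.
  have [-> -> -> Em] := gadget_op_sound par Et lt_pc' Epc E2 E3 E4 Eout E5 E6 E7 E8 op.
  by split=> // c lt_c; rewrite Em // Emem.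
have inv i : i < A -> [/\ vr 0 i = pc (s i), vr 9 i = outreg (s i), intape (s i) = [::] &
    forall c : word m, c < A -> vc 0 i c = mem (s i) c].
  elim: i => [|i IH] lt_i.
    have T a : a < A -> [&& vr 0 0 == 0, vr 9 0 == 0 & vc 0 0 a == nth 0 l a].
      by move=> /(tab 0 a lt_i); rewrite tableauE => /andP[].
    have /and3P[/eqP -> /eqP -> _] := T 0 A_gt0; rewrite /= mod0n; split=> // c /T.
    by move=> /and3P[_ _ /eqP ->]; rewrite modn_small.
  have lt_i' := ltnW lt_i; have [_ _ [E12 E13 Et Emem]] := row i lt_i' (IH lt_i').
  have T a : a < A -> [&& vr 0 i.+1 == vr 12 i, vr 9 i.+1 == vr 13 i
                       & vc 0 i.+1 a == if a == vr 10 i then vr 11 i else vc 0 i a].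
    move=> /(tab i a lt_i'); rewrite tableauE.
    by move=> /and5P[_ _ _ _ /and5P[_ _ _ _ /and5P[_ _ _ /implyP H _]]]; apply: H.
  have /and3P[/eqP -> /eqP -> _] := T 0 A_gt0; split=> // c lt_c.
  by have /and3P[_ _ /eqP ->] := T c lt_c; rewrite Emem.
have lt_A : A.-1 < A by rewrite prednK.
have Inv := inv _ lt_A; have [Eop E1 _] := row _ lt_A Inv; have [_ Eout _ _] := Inv.
have := tab _ 0 lt_A A_gt0; rewrite tableauE prednK // ltnn.
move=> /and5P[_ _ _ _ /and5P[_ _ _ _ /and5P[_ _ _ _ /andP[halt /eqP Eb]]]].
by rewrite -Eout /halted -Eop nth_opcodes_halt.
Qed.

Lemma tableau_complete S : S + 3 <= A -> size l <= A ->
  (forall j, j < A -> all (fun c : word m => c < S) (accessed (s j))) ->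
  halted (s A.-1) -> nat_of_ord (outreg (s A.-1)) = gv 3 ->
  exists vc vr, [/\ forall x i a, vc x i a < D, forall x i, vr x i < D &
    forall i a, i < A -> a < A -> holds vc vr (tableau cells) i a].
Proof.
move=> leSA le_l acc halt Eb.
have Et i : intape (s i) = [::].
  by elim: i => //= i IH; rewrite /step; case: (current_op _) => //=; rewrite IH.
have WD x : x < 2 ^ m -> x < D.
  by move=> lt; apply: leq_trans lt _; rewrite leq_exp2l //; lia.
have ex i : i < A -> exists aux, all (fun n => n < D) aux /\ forall vc (vr : nat -> nat -> nat) i' a,
      (forall n, vr n i' = nth 0 (registers A (s i) ++ aux) n) ->
      holds vc vr (gadget_op (current_op (s i))) i' a.
  by move=> /acc /(gadget_op_complete par (Et i) leSA) [aux aux1 aux2]; exists aux.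
have [aux auxP] := bounded_choice [::] ex.
pose vc (x i a : nat) : nat := mem (s i) (to_word m a).
(* The value 0 beyond the last row keeps the bound valid for all [i], whereas [auxP] only speaks
   about [i < A]. *)
pose vr (n i : nat) : nat := if i < A then nth 0 (registers A (s i) ++ aux i) n else 0.
have vrE n i : i < A -> vr n i = nth 0 (registers A (s i) ++ aux i) n by rewrite /vr => ->.
exists vc, vr; split=> [x i a|n i|i a lt_i lt_a].
- by apply: WD; apply: ltn_ord.
- rewrite /vr; case: ifP => lt_i; last by rewrite expn_gt0.
  have lt_t : target A (s i) < D.
    by apply: WD; rewrite /target; case: (current_op _) => *; rewrite ?ltn_ord.
  have : all (fun n => n < D) (registers A (s i) ++ aux i).
    rewrite all_cat (auxP i lt_i).1 andbT /= lt_t !WD //; exact: ltn_ord.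
  have [lt_n|ge_n] := ltnP n (size (registers A (s i) ++ aux i)).
    by move=> /allP; apply; apply: mem_nth.
  by rewrite nth_default // expn_gt0.
have to_wE c : c < A -> nat_of_ord (to_word m c) = c by move=> lt_c; rewrite to_wordE //; lia.
have lt_pc : pc (s i) < S.
  by have := acc i lt_i; rewrite /accessed all_cat /= addn0 modn_small // => /andP[/andP[]].
rewrite tableauE !(vrE _ i lt_i) /= /vc.
have opOK : holds vc vr (gadget_op (current_op (s i))) i a.
  by apply: (auxP i lt_i).2 => n; apply: vrE.
rewrite -/(current_op _) -/vc opOK /=.
have mE (c : word m) : (a == c) ==> (nat_of_ord (mem (s i) (to_word m a)) == mem (s i) c).
  by apply/implyP => /eqP ->; rewrite to_wordK.
have fE j : (a == pc (s i) + j) ==> (nat_of_ord (mem (s i) (to_word m a)) == fetch (s i) j).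
  by apply/implyP => /eqP ->.
rewrite !mE !fE -[X in a == X]addn0 fE /=.
apply/and4P; split.
- apply/implyP => /eqP ->; rewrite /= mod0n /=.
  by rewrite modn_small // (modn_small (ltn_trans lt_a A_lt)).
- by lia.
- apply/implyP => lt_i1; rewrite !(vrE _ i.+1 lt_i1) !eqxx /=.
  case: (eqVneq a (target A (s i))) => [->|ne_a]; first by rewrite eqxx.
  apply/eqP; congr nat_of_ord; move: ne_a.
  have updE (f : word m -> word m) (z : word m) w : a != z -> upd f z w (to_word m a) = f (to_word m a).
    by rewrite /upd -val_eqE /= => /negbTE; rewrite (modn_small (ltn_trans lt_a A_lt)) => ->.
  by rewrite /target /step; case: (current_op _) => //= *; rewrite updE.
apply/implyP => ge_i; have Ei : i = A.-1 by lia.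
by rewrite -nth_opcodes_halt Ei Eb eqxx andbT; apply: halt.
Qed.

End Tableau.

(** * Existential closure *)

Lemma term_sem_ext m (e e' : nat -> word m) u :
  (forall i, i \in term_vars u -> e i = e' i) -> term_sem e u = term_sem e' u.
Proof.
elim: u => //= [i|f u IH|f u IHu v IHv] ee'; first by rewrite ee' ?inE.
  by rewrite IH.
by rewrite IHu ?IHv // => i i_in; apply: ee'; rewrite mem_cat i_in ?orbT.
Qed.

Lemma sat_ext m (e e' : nat -> word m) p : quantifier_free p ->
  (forall i, i \in free_vars p -> e i = e' i) -> sat e p <-> sat e' p.
Proof.
elim: p e e' => //= [u v|p IH|p IHp q IHq|p IHp q IHq|p IHp q IHq] e e'.
- by move=> _ ee'; rewrite !(@term_sem_ext _ e e') // => i i_in; apply: ee'; rewrite mem_cat i_in ?orbT.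
- by move=> qf ee'; have := IH e e' qf ee'; tauto.
all: move=> /andP[qfp qfq] ee'.
all: have Ep : sat e p <-> sat e' p by apply: IHp => // i ip; apply: ee'; rewrite mem_cat ip.
all: have Eq : sat e q <-> sat e' q by apply: IHq => // i iq; apply: ee'; rewrite mem_cat iq orbT.
all: tauto.
Qed.

Lemma sat_foldr_ex m (e : nat -> word m) p vs : quantifier_free p ->
  sat e (foldr FEx p vs) <->
  exists2 e' : nat -> word m, (forall i, i \notin vs -> e' i = e i) & sat e' p.
Proof.
move=> qf; elim: vs e => [|x vs IH] e /=.
  split=> [sat_e|[e' ee' sat_e']]; first by exists e.
  have [H _] : sat e' p <-> sat e p by apply: sat_ext => // i _; rewrite ee'.
  exact: H.
split=> [[a /IH [e' ee' sat_e']] | [e' ee' sat_e']].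
  exists e' => // i; rewrite inE negb_or => /andP[ne_i /ee' ->].
  by rewrite /upd (negbTE ne_i).
exists (e' x); apply/IH; exists e' => // i ni; rewrite /upd.
by case: eqP => [-> //|/eqP ne_i]; apply: ee'; rewrite inE negb_or ne_i.
Qed.

(** All indices from [n] up to at least the largest free variable are quantified, so that the
    witnesses of the tableau need not be counted. *)
Lemma existential_closure n p : quantifier_free p -> exists psi,
  [/\ existential psi, all (fun i => i < n) (free_vars psi) &
      forall m (e : nat -> word m), sat e psi <->
        exists2 e' : nat -> word m, (forall i, i < n -> e' i = e i) & sat e' p].
Proof.
move=> qf; pose vs := iota n (\max_(i <- free_vars p) i).+1.
exists (foldr FEx p vs).
have fv ws : free_vars (foldr FEx p ws) = [seq i <- free_vars p | i \notin ws].
  elim: ws => [|x ws IH] /=; first by rewrite filter_predT.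
  by rewrite IH -filter_predI; apply: eq_filter => i; rewrite /= inE negb_or.
have big i : i \in free_vars p -> i \in vs = (n <= i).
  move=> i_in; rewrite mem_iota andb_idr // => _; rewrite addnS ltnS.
  by apply: leq_trans (leq_addl _ _); apply: (@leq_bigmax_seq _ _ xpredT id).
split.
- elim: vs {big} => //=; case: p qf {fv} => //=.
- by rewrite fv; apply/allP => i; rewrite mem_filter => /andP[ni /big]; rewrite (negbTE ni); lia.
move=> m e; rewrite sat_foldr_ex //; split=> -[e' ee' sat_e'].
  by exists e' => // i lt_i; apply: ee'; rewrite mem_iota; lia.
exists (fun i => if i \in vs then e' i else e i) => [i /negbTE -> //|].
set e'' := fun i => _; have [H _] : sat e' p <-> sat e'' p; last exact: H.
by apply: sat_ext => // i /big in_vs; rewrite /e'' in_vs; case: leqP => // lt_i; apply: ee'.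
Qed.

Definition FBigOr (ps : seq Mformula) : Mformula := foldr FOr (FNot (FEq tzero tzero)) ps.
Definition FBigAnd (ps : seq Mformula) : Mformula := foldr FAnd (FEq tzero tzero) ps.

Lemma qf_bigor ps : quantifier_free (FBigOr ps) = all quantifier_free ps.
Proof. by elim: ps => //= p ps <-. Qed.

Lemma qf_bigand ps : quantifier_free (FBigAnd ps) = all quantifier_free ps.
Proof. by elim: ps => //= p ps <-. Qed.

Lemma sat_bigor (T : eqType) m (e : nat -> word m) (f : T -> Mformula) xs :
  sat e (FBigOr [seq f x | x <- xs]) <-> exists2 x, x \in xs & sat e (f x).
Proof.
elim: xs => [|x xs IH] /=; first by split=> [[]|[]].
rewrite IH; split=> [[sx|[y y_in sy]]|[y]].
- by exists x; rewrite ?mem_head.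
- by exists y; rewrite // inE y_in orbT.
by rewrite inE => /orP[/eqP ->|y_in sy]; [left | right; exists y].
Qed.

Lemma sat_bigand (T : eqType) m (e : nat -> word m) (f : T -> Mformula) xs :
  sat e (FBigAnd [seq f x | x <- xs]) <-> forall x, x \in xs -> sat e (f x).
Proof.
elim: xs => [|x xs IH] /=; first by split.
rewrite IH; split=> [[sx sxs] y|sxs].
  by rewrite inE => /orP[/eqP ->|/sxs].
by split=> [|y y_in]; apply: sxs; rewrite ?mem_head // inE y_in orbT.
Qed.

Lemma sat_eq m (e : nat -> word m) u v x y :
  teval e u x -> teval e v y -> sat e (FEq u v) <-> x = y.
Proof. by rewrite /teval /= => <- <-; split=> [->|/val_inj]. Qed.

(** * Saturated numerals and the finite table *)

(* Unlike [tnum n], these do not wrap around when [n] is too large for [M_v]. *)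
Definition tsatnum (n : nat) : Mterm := iter n (fun u => TBin Bmax u (tadd u tone)) tzero.

Lemma teval_satnum m (e : nat -> word m) n : 0 < m -> teval e (tsatnum n) (minn n (2 ^ m - 1)).
Proof.
move=> m_gt0; have W_gt1 : 1 < 2 ^ m by rewrite -{1}(expn0 2) ltn_exp2l.
elim: n => [|n IH]; first by rewrite min0n; apply: teval_zero.
rewrite /teval /= -/(tsatnum n) IH [1 %% _]modn_small //; have [le|lt] := leqP (2 ^ m - 1) n.
  have -> : 2 ^ m - 1 + 1 = 2 ^ m by lia.
  by rewrite modnn maxn0 modn_small; lia.
by rewrite (@modn_small (n + 1)) ?modn_small; lia.
Qed.

Lemma expn_expn_gt v : v + 1 < 2 ^ 2 ^ v.
Proof.
have := @ltn_expl 2 v isT => lt_v; apply: leq_ltn_trans (_ : 2 ^ v < _); last exact: ltn_expl.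
by rewrite addn1.
Qed.

Section Assembly.
Variable k : nat.
Local Notation ty := (TVar k).
Local Notation tz := (TVar (k + 1)).
Local Notation tt := (TVar (k + 2)).

Definition args d t (a : k.-tuple (M d)) (b : M d) : seq nat :=
  [seq (x : nat) | x : M d <- a] ++ [:: b : nat; d; t].

Section Args.
Variables (d t v : nat) (a : k.-tuple (M d)) (b : M d) (e : nat -> word (2 ^ v)).
Hypothesis le_td : t <= d.
Hypothesis le_dv : d <= v.
Hypothesis eE : forall i, i < k + 3 -> e i = to_word (2 ^ v) (nth 0 (args t a b) i).

Let M_lt (x : M d) : x < 2 ^ 2 ^ v.
Proof. by apply: leq_trans (ltn_ord _) _; rewrite !leq_exp2l. Qed.

Lemma teval_z : teval e tz d.
Proof.
apply: teval_var; rewrite eE ?ltn_add2l // /args nth_cat size_map size_tuple ltnNge leq_addr addKn /=.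
by rewrite modn_small //; have := expn_expn_gt v; lia.
Qed.

Lemma teval_t : teval e tt t.
Proof.
apply: teval_var; rewrite eE ?ltn_add2l // /args nth_cat size_map size_tuple ltnNge leq_addr addKn /=.
by rewrite modn_small //; have := expn_expn_gt v; lia.
Qed.

Lemma teval_y : teval e ty b.
Proof.
apply: teval_var; rewrite eE; last by lia.
by rewrite /args nth_cat size_map size_tuple ltnn subnn /= modn_small.
Qed.

Lemma teval_x i : i < k -> teval e (TVar i) (nth 0 [seq (x : nat) | x : M d <- a] i).
Proof.
move=> lt_i; apply: teval_var; rewrite eE ?ltn_addr //.
rewrite /args nth_cat size_map size_tuple lt_i /= modn_small //.
by rewrite (nth_map (to_word _ 0)) ?size_tuple.
Qed.

End Args.

Definition table_row (F : fun_family k) d t (a : k.-tuple (M d)) : Mformula :=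
  FAnd (FEq tz (tsatnum d)) (FAnd (FEq tt (tsatnum t)) (FAnd (FEq ty (tnum (F d t a)))
    (FBigAnd [seq FEq (TVar i) (tnum (nth 0 [seq (x : nat) | x : M d <- a] i)) | i <- iota 0 k]))).

Definition table (F : fun_family k) d1 : Mformula :=
  FBigOr [seq FBigOr [seq FBigOr [seq table_row F t a | a <- enum {: k.-tuple 'I_(2 ^ 2 ^ d)}]
                     | t <- iota 0 d.+1] | d <- iota 0 d1].

Lemma qf_table F d1 : quantifier_free (table F d1).
Proof.
rewrite /table qf_bigor all_map; apply/allP => d _; rewrite [preim _ _ _]qf_bigor all_map.
apply/allP => t _; rewrite [preim _ _ _]qf_bigor all_map; apply/allP => a _.
by rewrite [preim _ _ _]/= qf_bigand all_map; apply/allP.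
Qed.

Lemma sat_table F d1 d t v (a : k.-tuple (M d)) (b : M d) (e : nat -> word (2 ^ v)) :
  t <= d -> d <= v ->
  (forall i, i < k + 3 -> e i = to_word (2 ^ v) (nth 0 (args t a b) i)) ->
  sat e (table F d1) <-> d < d1 /\ F d t a = b.
Proof.
move=> le_td le_dv eE.
have m_gt0 : 0 < 2 ^ v by rewrite expn_gt0.
have lt_v := expn_expn_gt v.
have lt_W d' (x : M d') : d' <= v -> x < 2 ^ 2 ^ v.
  by move=> le; apply: leq_trans (ltn_ord x) _; rewrite !leq_exp2l.
rewrite sat_bigor; split=> [[d' d'_in] | [lt_d Eb]].
  rewrite sat_bigor => -[t' t'_in]; rewrite sat_bigor => -[a' _].
  case=> /(sat_eq (teval_z le_td le_dv eE) (teval_satnum _ d' m_gt0)) Ed.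
  case=> /(sat_eq (teval_t le_td le_dv eE) (teval_satnum _ t' m_gt0)) Et.
  (* Saturation sets in at [2 ^ 2 ^ v - 1], which exceeds [v >= d]; a saturated numeral is therefore
     never mistaken for [d]. *)
  have {}Ed : d = d' by lia.
  have {}Et : t = t' by lia.
  subst d' t'; case=> /(sat_eq (teval_y le_td le_dv eE) (teval_num _ (lt_W _ _ le_dv))) Eb.
  move=> /sat_bigand Ea; split; first by move: d'_in; rewrite mem_iota; lia.
  apply: ord_inj; rewrite Eb; congr (nat_of_ord (F d t _)); apply: eq_from_tnth => i.
  have lt_i := ltn_ord i; have := Ea i; rewrite mem_iota lt_i => /(_ isT).
  have nE (u : k.-tuple (M d)) : nth 0 [seq (x : nat) | x : M d <- u] i = tnth u i.
    by rewrite (nth_map (tnth u i)) ?size_tuple // -tnth_nth.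
  by rewrite (sat_eq (teval_x le_dv eE lt_i) (teval_num _ _)) nE ?nE; [move/val_inj|exact: lt_W].
exists d; first by rewrite mem_iota.
rewrite sat_bigor; exists t; first by rewrite mem_iota.
rewrite sat_bigor; exists a; first by rewrite mem_enum.
split; first by apply/(sat_eq (teval_z le_td le_dv eE) (teval_satnum _ d m_gt0)); lia.
split; first by apply/(sat_eq (teval_t le_td le_dv eE) (teval_satnum _ t m_gt0)); lia.
split; first by apply/(sat_eq (teval_y le_td le_dv eE) (teval_num _ (lt_W _ _ le_dv))); rewrite Eb.
apply/sat_bigand => i; rewrite mem_iota => /andP[_ lt_i].
apply/(sat_eq (teval_x le_dv eE lt_i) (teval_num _ _)) => //.
by rewrite (nth_map (to_word _ 0)) ?size_tuple //; apply: lt_W.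
Qed.

End Assembly.

Lemma iter_step_halted m (s : config m) n : halted s -> iter n (@step m) s = s.
Proof.
move=> hs; have fs : step s = s by move: hs; rewrite /halted /step; case: (current_op s).
by elim: n => //= n ->.
Qed.

Lemma sq_le_expn d : 4 <= d -> d * d <= 2 ^ d.
Proof.
elim: d => // d IH; rewrite leq_eqVlt => /orP[/eqP <- //|lt].
have := IH lt; rewrite expnS; nia.
Qed.

Section Assembly.
Variables (k : nat) (P : seq nat).
Local Notation ty := (TVar k).
Local Notation tz := (TVar (k + 1)).
Local Notation tt := (TVar (k + 2)).
Local Notation L := (size P + (3 + k)).

Definition memory d t (a : k.-tuple (M d)) : seq nat :=
  P ++ [:: k; d; t] ++ [seq (x : nat) | x : M d <- a].

Lemma size_memory d t (a : k.-tuple (M d)) : size (memory t a) = L.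
Proof. by rewrite /memory !size_cat size_map size_tuple. Qed.

(** * One step of computation: the case [t = d] *)

Definition memory_terms : seq Mterm :=
  map tnum P ++ [:: tnum k; tz; tt] ++ [seq TVar i | i <- iota 0 k].

(** Within one step the output register can leave its initial value 0 only if the first instruction
    is [OOutput], whose code is 19. The cell to be output is named by cell 1 and lies in the initial
    memory by the space bound, so a finite disjunction finds it. *)
Definition one_step : Mformula :=
  FOr (FAnd (FEq (nth tzero memory_terms 0) (tnum 19))
            (FBigOr [seq FAnd (FEq (nth tzero memory_terms 1) (tnum c))
                              (FEq ty (nth tzero memory_terms c)) | c <- iota 0 L]))
      (FAnd (FNot (FEq (nth tzero memory_terms 0) (tnum 19))) (FEq ty tzero)).

Lemma qf_one_step : quantifier_free one_step.
Proof. by rewrite /= qf_bigor all_map andbT; apply/allP. Qed.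

Lemma memory_lt d t (a : k.-tuple (M d)) c : t <= d -> sumn P + k <= d ->
  nth 0 (memory t a) c < 2 ^ 2 ^ d.
Proof.
move=> le_td le_d.
have lt_d x : x <= d -> x < 2 ^ 2 ^ d by have := expn_expn_gt d; lia.
suff /allP H : all (fun x => x < 2 ^ 2 ^ d) (memory t a).
  have [lt_c|ge_c] := ltnP c (size (memory t a)); first by apply/H/mem_nth.
  by rewrite nth_default // expn_gt0.
rewrite !all_cat; apply/and3P; split.
- apply/allP => x x_in; apply: lt_d; apply: leq_trans (leq_trans (leq_addr _ _) le_d).
  elim: P x_in => //= y s IH; rewrite inE => /orP[/eqP ->|/IH]; lia.
- by rewrite /= !lt_d //; lia.
by apply/allP => x /mapP[y _ ->]; apply: ltn_ord.
Qed.

Lemma teval_memory d t v (a : k.-tuple (M d)) (b : M d) (e : nat -> word (2 ^ v)) c :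
  t <= d -> d <= v -> sumn P + k <= d ->
  (forall i, i < k + 3 -> e i = to_word (2 ^ v) (nth 0 (args t a b) i)) ->
  teval e (nth tzero memory_terms c) (nth 0 (memory t a) c).
Proof.
move=> le_td le_dv le_d eE; have := memory_lt a c le_td le_d.
have W : 2 ^ 2 ^ d <= 2 ^ 2 ^ v by rewrite !leq_exp2l.
rewrite /memory_terms /memory !nth_cat !size_map; case: (ltnP c (size P)) => [lt_c|ge_c] lt.
  by rewrite (nth_map 0) //; apply: teval_num; apply: leq_trans W.
move: lt; set c' := c - _ => lt.
case: c' lt => [|[|[|c']]] /= lt; first by apply: teval_num; apply: leq_trans W.
- exact: teval_z le_td le_dv eE.
- exact: teval_t le_td le_dv eE.
rewrite !subSS subn0; have [lt_c|ge_c'] := ltnP c' k.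
  by rewrite (nth_map 0) ?size_iota // nth_iota // add0n; apply: (teval_x le_dv eE).
by rewrite !nth_default ?size_map ?size_iota ?size_tuple //; apply: teval_zero.
Qed.

Lemma sat_one_step d v (a : k.-tuple (M d)) (b f : M d) (e : nat -> word (2 ^ v)) :
  d <= v -> sumn P + k + L + 19 <= d ->
  (forall i, i < k + 3 -> e i = to_word (2 ^ v) (nth 0 (args d a b) i)) ->
  computes (memory d a) L 1 f -> sat e one_step <-> f = b.
Proof.
move=> le_dv le_d eE comp.
have le_d' : sumn P + k <= d by lia.
have lt_v := expn_expn_gt v.
have tm c := teval_memory c (leqnn d) le_dv le_d' eE.
have mlt c := memory_lt a c (leqnn d) le_d'.
have ty_b := teval_y (leqnn d) le_dv eE.
set l := memory d a in comp tm mlt *.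
set s0 := init_config (2 ^ d) l in comp.
have memE (c : word (2 ^ d)) : nat_of_ord (mem s0 c) = nth 0 l c by rewrite /= modn_small.
have Wd := expn_expn_gt d.
have f0 : nat_of_ord (fetch s0 0) = nth 0 l 0 by rewrite memE /= mod0n mod0n.
have f1 : nat_of_ord (fetch s0 1) = nth 0 l 1.
  by rewrite memE /= mod0n modn_small //; lia.
(* If no step is made, the first code is a halting one and not 19; if one step is made, only
   [OOutput] changes the output register. *)
have Ef : nat_of_ord f = if nth 0 l 0 == 19 then nth 0 l (nth 0 l 1) else 0.
  case: comp => i le_i [hs <- _].
  have no_out : nth 0 l 0 <> 19 -> current_op s0 <> OOutput.
    rewrite -f0 /current_op; move: (nat_of_ord (fetch s0 0)) => n.
    by do 20! (case: n => [//|n]); rewrite nth_default.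
  case: i le_i hs => [|[|//]] _ /= hs.
    case: eqP => [E19|_]; last by rewrite mod0n.
    by move: hs; rewrite /halted /current_op f0 E19.
  case: eqP => [E19|/no_out].
    by rewrite -f1 -memE /step /current_op f0 E19.
  by rewrite /step; case: (current_op s0) => //= *; rewrite mod0n.
have acc1 : nth 0 l 0 = 19 -> nth 0 l 1 < L.
  case: comp => i _ [_ _ /(_ 0 (leq0n i))]; rewrite /accessed all_cat => /andP[_].
  by rewrite -f1 /current_op f0 => + E19; rewrite E19 => /andP[].
have n19 : teval e (tnum 19) 19 by apply: teval_num; lia.
have -> : f = b <-> nat_of_ord b = nat_of_ord f by split=> [->|/ord_inj].
rewrite Ef; split.
  case=> -[]; first move=> /(sat_eq (tm 0) n19) -> /=.
    move=> /sat_bigor[c]; rewrite mem_iota => /andP[_ lt_c] [].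
    have nc : teval e (tnum c) c by apply: teval_num; lia.
    by move=> /(sat_eq (tm 1) nc) -> /(sat_eq ty_b (tm c)).
  move=> ne /(sat_eq ty_b (teval_zero e)) ->; case: eqP => // E19.
  by case: ne; apply/(sat_eq (tm 0) n19).
case: eqP => [E19 | ne] Eb; [left|right]; split.
- by apply/(sat_eq (tm 0) n19).
- apply/sat_bigor; exists (nth 0 l 1); first by rewrite mem_iota acc1.
  split; last by apply/(sat_eq ty_b (tm _)).
  by apply/(sat_eq (tm 1)); [apply: teval_num; have := acc1 E19; lia|].
- by move=> /(sat_eq (tm 0) n19).
by apply/(sat_eq ty_b (teval_zero e)).
Qed.

End Assembly.

(** * The case [t < d] *)

Section Main.
Variables (k : nat) (P : seq nat) (g : nat).
Local Notation ty := (TVar k).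
Local Notation tz := (TVar (k + 1)).
Local Notation tt := (TVar (k + 2)).
Local Notation L := (size P + (3 + k)).

Definition tE : Mterm := tpow (tdiv (tadd tz tone) (tnum 2)).
(** Products of two words and the power [2 ^ (E * E)] are at most [2 ^ (2 * m)]; [4 * m] bits hold
    them with a margin. *)
Definition tdw4 : Mterm := tmul (tnum 4) (tpow tz).
Definition tside : Mterm := tpow (tmul (tnum g) (tsub tz tt)).
(** Ordered as the parameters [PG]: those of the machine with the claimed output at 3, then [d] and
    [t] at 8 and 9, and the arguments from 10 on. *)
Definition param_terms : seq Mterm :=
  [:: tside; tpow (tpow tz); tpow tz; ty; tE; tpred (tpow tE); tpred (tpred (tpow tE));
      tpow (tmul tE tE); tz; tt] ++ [seq TVar i | i <- iota 0 k].
Definition param_values d t (a : k.-tuple (M d)) (b : M d) (A E : nat) : seq nat :=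
  [:: A; 2 ^ 2 ^ d; 2 ^ d; b : nat; E; 2 ^ E - 1; 2 ^ E - 2; 2 ^ (E * E); d; t] ++
  [seq (x : nat) | x : M d <- a].
Definition memory_cells : seq pexp :=
  map PC P ++ [:: PC k; PG 8; PG 9] ++ [seq PG (10 + i) | i <- iota 0 k].
(** The tableau expression depends on [k] and the program only, and so does its degree; hence [K]
    may enter the constant [c]. *)
Definition main_degree : nat := pdeg (PLe (PC 1) (tableau memory_cells)).
Local Notation K := main_degree.
Definition main_formula : Mformula :=
  tableau_formula (k + 3) (nth tzero param_terms) tdw4 tside K (tableau memory_cells).

Section Values.
Variables (d t v : nat) (a : k.-tuple (M d)) (b f : M d).
Local Notation m := (2 ^ d).
Local Notation A := (2 ^ (g * (d - t))).
Local Notation E := (2 ^ (d.+1 %/ 2)).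
Local Notation W := (2 ^ 2 ^ v).
Local Notation N := (A * A).
Local Notation gv := (nth 0 (param_values t a b A E)).
Local Notation w := (4 * m * K.+1).
Hypothesis lt_td : t < d.
Hypothesis d_big : sumn P + k + L + g + 30 <= d.
Hypothesis v_big : d + (4 * g + 12 * K.+1) * (d - t) <= v.

Let le_td : t <= d. Proof. exact: ltnW. Qed.
Let le_dv : d <= v. Proof. exact: leq_trans (leq_addr _ _) v_big. Qed.

Let A_lt : A < 2 ^ m.
Proof.
rewrite ltn_exp2l //; apply: leq_trans (_ : d * d <= _); last by apply: sq_le_expn; lia.
have le : g * (d - t) <= g * d by rewrite leq_mul2l leq_subr orbT.
by apply: leq_ltn_trans le _; rewrite ltn_mul2r; lia.
Qed.

(** With [N = A ^ 2], the left side is at most [4 m (K + 1) * 3 A ^ 4]. This explains the exponent: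
    [4 * g] pays for [A ^ 4], and since [t < d], the factor [12 (K + 1)] is below 2 to the power
    [12 (K + 1) (d - t)]. *)
Lemma main_bits : w * (N * (N + 2)) < 2 ^ v.
Proof.
apply: leq_trans (_ : 2 ^ (d + (4 * g + 12 * K.+1) * (d - t)) <= _); last by rewrite leq_exp2l.
have A_gt0 : 0 < A by rewrite expn_gt0.
have -> : 2 ^ (d + (4 * g + 12 * K.+1) * (d - t)) = m * (A ^ 4 * 2 ^ (12 * K.+1 * (d - t))).
  by rewrite -expnM -!expnD mulnDl (mulnC _ 4) mulnA.
have lt12 : 12 * K.+1 < 2 ^ (12 * K.+1 * (d - t)).
  apply: leq_trans (ltn_expl (12 * K.+1) (isT : 1 < 2)) _; rewrite leq_exp2l // leq_pmulr //; lia.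
have le3 : N * (N + 2) <= 3 * A ^ 4.
  have -> : A ^ 4 = N * N by rewrite (expnD A 2 2) -mulnn.
  have : 0 < N by rewrite muln_gt0 A_gt0.
  nia.
have le4 : w * (N * (N + 2)) <= w * (3 * A ^ 4) by rewrite leq_mul2l le3 orbT.
apply: leq_ltn_trans le4 _.
have -> : w * (3 * A ^ 4) = m * (A ^ 4 * (12 * K.+1)) by lia.
by rewrite !ltn_pmul2l ?expn_gt0 ?A_gt0.
Qed.

Let E_sqr : m <= E * E /\ E * E <= 2 * m.
Proof. by rewrite -expnD -expnS !leq_exp2l //; lia. Qed.

Let E_gt2 : 2 < E.
Proof. by apply: leq_trans (_ : 2 ^ 2 <= _); rewrite // leq_exp2l //; lia. Qed.

Lemma main_params : machine_params m E A gv.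
Proof. by have [le1 le2] := E_sqr; split. Qed.

Let m_lt_v : 4 * m < 2 ^ v.
Proof.
apply: leq_ltn_trans main_bits; have : 0 < A by rewrite expn_gt0.
move=> A_gt0; rewrite -mulnA leq_pmulr // !muln_gt0 A_gt0 /=; lia.
Qed.

Let W_gt x : x <= 2 ^ v -> x < W.
Proof. by move=> le; apply: leq_ltn_trans le _; apply: ltn_expl. Qed.

Lemma main_values_lt i : gv i < 2 ^ (4 * m).
Proof.
have m0 : 0 < m by rewrite expn_gt0.
have lt_m x : x <= 2 * m -> 2 ^ x < 2 ^ (4 * m) by move=> le; rewrite ltn_exp2l //; lia.
have lt_w x : x < 2 ^ m -> x < 2 ^ (4 * m).
  by move=> lt; apply: ltn_trans lt _; apply: lt_m; lia.
have [le1 le2] := E_sqr.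
have dm : d < m by apply: ltn_expl.
have mm : m < 2 ^ m by apply: ltn_expl.
have lt_E : E < 2 ^ m by apply: leq_ltn_trans mm; rewrite leq_exp2l //; lia.
have leE : E <= 2 * m by apply: leq_trans le2; rewrite leq_pmulr //; lia.
have lt_Q := lt_m _ leE.
suff /allP H : all (fun x => x < 2 ^ (4 * m)) (param_values t a b A E).
  have [lt_c|ge_c] := ltnP i (size (param_values t a b A E)); first by apply/H/mem_nth.
  by rewrite nth_default // expn_gt0.
rewrite all_cat; apply/andP; split; last by apply/allP => x /mapP[y _ ->]; apply/lt_w/ltn_ord.
have lt_d := ltn_trans dm mm.
rewrite /=; have -> : 2 ^ m < 2 ^ (4 * m) by apply: lt_m; lia.
rewrite (lt_w _ A_lt) (lt_w m) // (lt_w b) ?ltn_ord // (lt_w _ lt_E) (lt_m (E * E)) // (lt_w d) //.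
rewrite (lt_w t (ltn_trans lt_td lt_d)) /=; lia.
Qed.

Section Env.
Variable e : nat -> word (2 ^ v).
Hypothesis eE : forall i, i < k + 3 -> e i = to_word (2 ^ v) (nth 0 (args t a b) i).

Let z_val := teval_z le_td le_dv eE.
Let t_val := teval_t le_td le_dv eE.

Lemma teval_side : teval e tside A.
Proof.
have lt : g * (d - t) < 2 ^ v.
  apply: leq_ltn_trans m_lt_v; have := A_lt; rewrite ltn_exp2l //; lia.
apply: teval_pow => //; apply: teval_mul; last by apply: W_gt; exact: ltnW.
  apply: teval_num; apply: W_gt; apply: leq_trans (ltnW m_lt_v).
  have := ltn_expl d (isT : 1 < 2); lia.
exact: teval_sub.
Qed.

Let m_val : teval e (tpow tz) m.
Proof. by apply: teval_pow => //; have := ltn_expl d (isT : 1 < 2); lia. Qed.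

Lemma teval_dw4 : teval e tdw4 (4 * m).
Proof.
apply: teval_mul => //; last by apply: W_gt; exact: ltnW.
apply: teval_num; apply: W_gt; apply: leq_trans (ltnW m_lt_v).
by rewrite leq_pmulr // expn_gt0.
Qed.

Lemma teval_E : teval e tE E.
Proof.
have dm := ltn_expl d (isT : 1 < 2).
apply: teval_pow; last by lia.
apply: teval_div; last by apply: teval_num; apply: W_gt; lia.
by rewrite -[d.+1]addn1; apply: teval_add => //; [apply: teval_one|]; apply: W_gt; lia.
Qed.

Lemma teval_params i : teval e (nth tzero param_terms i) (gv i).
Proof.
have [le1 le2] := E_sqr.
have leE : E <= 2 * m by apply: leq_trans le2; rewrite leq_pmulr //; lia.
have Q_val : teval e (tpow tE) (2 ^ E) by apply: teval_pow teval_E _; lia.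
have Q4 : 4 <= 2 ^ E by apply: (@leq_pexp2l 2 2); lia.
have Q1_val : teval e (tpred (tpow tE)) (2 ^ E - 1) by apply: teval_pred => //; lia.
do 10? [case: i => [|i]]; rewrite /=.
- exact: teval_side.
- by apply: teval_pow => //; lia.
- exact: m_val.
- exact: teval_y le_td le_dv eE.
- exact: teval_E.
- exact: Q1_val.
- by rewrite (_ : 2 ^ E - 2 = 2 ^ E - 1 - 1); [apply: teval_pred => //|]; lia.
- apply: teval_pow; last by lia.
  by apply: teval_mul teval_E teval_E _; apply: W_gt; lia.
- exact: z_val.
- exact: t_val.
have [lt_i|ge_i] := ltnP i k.
  by rewrite (nth_map 0) ?size_iota // nth_iota // add0n; apply: (teval_x le_dv eE).
by rewrite !nth_default ?size_map ?size_iota ?size_tuple //; apply: teval_zero.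
Qed.

End Env.

Lemma peval_memory_cells vc vr i c x :
  peval vc vr gv A (nth (PC 0) memory_cells x) i c = nth 0 (memory P t a) x.
Proof.
rewrite /memory_cells /memory !nth_cat !size_map; case: ltnP => [lt_x|ge_x].
  by rewrite (nth_map 0).
case: (x - size P) => [|[|[|x']]] //=.
rewrite !subSS subn0; have [lt_x|ge_x'] := ltnP x' k.
  by rewrite (nth_map 0) ?size_iota // nth_iota.
by rewrite !nth_default ?size_map ?size_iota ?size_tuple.
Qed.

Variables (S T : nat).
Hypothesis comp : computes (memory P t a) S T f.
Hypothesis S_le : S + 3 <= A.
Hypothesis T_lt : T < A.
Hypothesis L_le : L <= A.

Let size_cells : size memory_cells = size (memory P t a).
Proof. by rewrite size_memory !size_cat !size_map size_iota. Qed.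

Let mem_lt c : nth 0 (memory P t a) c < 2 ^ m.
Proof. by apply: memory_lt => //; lia. Qed.

Local Notation s i := (iter i (@step m) (init_config m (memory P t a))).

(** Halted configurations are fixed by [step], so the run extends up to the last row without
    accessing new cells. *)
Let comp_final : [/\ halted (s A.-1), outreg (s A.-1) = f &
  forall j, all (fun c : word m => c < S) (accessed (s j))].
Proof.
have [i le_i [hs out acc]] := comp.
have fin j : i <= j -> s j = s i.
  by move=> le; rewrite -(subnK le) iterD iter_step_halted.
have Ei : s A.-1 = s i by apply: fin; lia.
rewrite Ei; split=> // j; have [le_j|/ltnW le_j] := leqP j i; first exact: acc.
by rewrite (fin _ le_j); apply: acc.
Qed.

Let m_gt0 : 0 < m. Proof. by rewrite expn_gt0. Qed.
Let dw_gt1 : 1 < 4 * m. Proof. by lia. Qed.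
Let A_gt0 : 0 < A. Proof. by rewrite expn_gt0. Qed.
Let A_ltD : A < 2 ^ (4 * m).
Proof. by apply: ltn_trans A_lt _; rewrite ltn_exp2l //; lia. Qed.

Lemma sat_main_sound (e : nat -> word (2 ^ v)) :
  (forall i, i < k + 3 -> e i = to_word (2 ^ v) (nth 0 (args t a b) i)) ->
  sat e main_formula -> f = b.
Proof.
move=> eE /(sat_tableau (k + 3) dw_gt1 A_gt0 A_ltD (teval_side eE) (teval_dw4 eE) (teval_params eE)
  main_values_lt main_bits (leqnn _)) tab.
have [_ out] := tableau_sound main_params size_cells mem_lt peval_memory_cells A_gt0 tab.
have [_ <- _] := comp_final; exact: ord_inj.
Qed.

Lemma sat_main_complete (e0 : nat -> word (2 ^ v)) : f = b ->
  (forall i, i < k + 3 -> e0 i = to_word (2 ^ v) (nth 0 (args t a b) i)) ->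
  exists2 e : nat -> word (2 ^ v), (forall i, i < k + 3 -> e i = e0 i) & sat e main_formula.
Proof.
move=> Efb e0E; have [hs out acc] := comp_final.
have out' : nat_of_ord (outreg (s A.-1)) = gv 3 by rewrite out Efb.
have le_l : size (memory P t a) <= A by rewrite size_memory.
have [vc [vr [vc_lt vr_lt tab]]] := tableau_complete main_params size_cells mem_lt
  peval_memory_cells S_le le_l (fun j _ => acc j) hs out'.
pose B := 2 ^ w.
pose wc x := pack B N (fun j => vc x (j %/ A) (j %% A)).
pose wr x := pack (B ^ A) A (vr x).
(* After the [k + 3] free variables, even offsets hold the cell vectors and odd ones the row
   vectors. *)
pose e i := if i < k + 3 then e0 i else
  to_word (2 ^ v) (let x := i - (k + 3) in if odd x then wr x./2 else wc x./2).
have eE i : i < k + 3 -> e i = e0 i by rewrite /e => ->.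
exists e => //.
have eE' i : i < k + 3 -> e i = to_word (2 ^ v) (nth 0 (args t a b) i).
  by move=> lt; rewrite eE // e0E.
have leDB : 2 ^ (4 * m) <= B by rewrite leq_exp2l // leq_pmulr.
have B_ltW x : x < B ^ N -> x < W.
  move=> lt; apply: ltn_trans lt _; rewrite -expnM ltn_exp2l //.
  by apply: leq_ltn_trans main_bits; rewrite leq_mul2l leq_pmulr ?orbT //; lia.
have eK x : e (k + 3 + x) = to_word (2 ^ v) (if odd x then wr x./2 else wc x./2).
  by rewrite /e ltnNge leq_addr addKn.
have e_cell x : nat_of_ord (e (k + 3 + x.*2)) = wc x.
  rewrite eK odd_double doubleK to_wordE //; apply: B_ltW.
  by apply: pack_lt => j _; apply: leq_trans leDB.
have e_row x : nat_of_ord (e (k + 3 + x.*2.+1)) = wr x.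
  rewrite eK oddS odd_double -[_./2]/(uphalf x.*2) uphalf_double to_wordE //; apply: B_ltW.
  rewrite expnM; apply: pack_lt => j _; apply: leq_trans (vr_lt _ _) _.
  by apply: leq_trans leDB _; rewrite -{1}(expn1 B) leq_pexp2l // expn_gt0.
apply: (sat_tableau_encode dw_gt1 A_gt0 A_ltD (teval_side eE') (teval_dw4 eE')
  (teval_params eE') main_values_lt main_bits vc_lt vr_lt e_cell e_row (leqnn _)) => i c lt_i lt_c.
exact: tab.
Qed.

End Values.

End Main.

Theorem theorem8 (k : nat) (F : fun_family k) (hF : zero_one_valued F) :
  poly_time_computable F -> poly_existential F.
Proof.
case=> gam [P [d0 comp]].
pose L := size P + (3 + k).
(* [gam] covers time and space. For [t < d] the summand [L + 4] contributes a factor of at least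
   [2 ^ (L + 4)], enough for the initial memory, the three spare columns and a number of rows above
   the time bound. *)
pose g := gam + L + 4.
pose d1 := d0 + sumn P + k + L + g + 30.
pose K := main_degree k P.
(* The maximum of [d] and [d1] being [d] expresses [d1 <= d]; the numeral saturates only above [d],
   so the equation is also correct in a small [M_v]. *)
pose large := FEq (TBin Bmax (TVar (k + 1)) (tsatnum d1)) (TVar (k + 1)).
pose diag := FEq (TVar (k + 1)) (TVar (k + 2)).
pose phi := FOr (table F d1) (FAnd large
  (FOr (FAnd diag (one_step k P)) (FAnd (FNot diag) (main_formula k P g)))).
have qf : quantifier_free phi.
  apply/andP; split; first exact: qf_table.
  by apply/andP; split=> //; apply/andP; split=> //; apply: qf_one_step.
have [psi [ex fv psiP]] := existential_closure (k + 3) qf.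
(* One unit of the coefficient lifts [t] to [d]; what remains is the bound on [v] under which the
   tableau fits. *)
exists (4 * g + 12 * K.+1).+1, psi; split=> // d t a b v le_td le_v.
have le_v' : d + (4 * g + 12 * K.+1) * (d - t) <= v.
  by apply: leq_trans le_v; rewrite (mulSn (4 * g + 12 * K.+1)) addnA subnKC.
have le_dv : d <= v := leq_trans (leq_addr _ _) le_v'.
set e0 := fun i => to_word (2 ^ v) (nth 0 (args t a b) i).
rewrite /M_sat -/(args t a b) -/e0 psiP.
have lt_v := expn_expn_gt v.
have v_gt0 : 0 < 2 ^ v by rewrite expn_gt0.
have cases e : (forall i, i < k + 3 -> e i = e0 i) ->
    (sat e large <-> d1 <= d) /\ (sat e diag <-> d = t).
  move=> eE; have tz := teval_z le_td le_dv eE; have tt := teval_t le_td le_dv eE.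
  split; last exact: sat_eq.
  have tsat := teval_satnum e d1 v_gt0.
  have tmax : teval e (TBin Bmax (TVar (k + 1)) (tsatnum d1)) (maxn d (minn d1 (2 ^ 2 ^ v - 1))).
    by rewrite /teval /= tz tsat modn_small; lia.
  by rewrite (sat_eq tmax tz); split; lia.
have [lt_d|ge_d] := ltnP d d1.
  split=> [Eb | [e eE]].
    by exists e0 => //; left; apply/(sat_table F d1 le_td le_dv).
  have [lgP _] := cases e eE.
  by case=> [/(sat_table F d1 le_td le_dv eE) [_ //]|[/lgP]]; lia.
have compF := comp d t a (_ : d0 <= d) le_td; have {}compF := compF ltac:(lia).
move: compF; rewrite -/(memory P t a) -/L => compF.
have not_table e : (forall i, i < k + 3 -> e i = e0 i) -> ~ sat e (table F d1).
  by move=> eE /(sat_table F d1 le_td le_dv eE) []; lia.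
move: le_td; rewrite leq_eqVlt => /orP[/eqP Etd | lt_td].
  (* The time bound becomes [2 ^ 0 = 1] and the space bound the length [L] of the initial memory. *)
  subst t; move: compF; rewrite subnn muln0 (maxn_idPl _) => [compF|]; last by rewrite /L; lia.
  have oneP e (eE : forall i, i < k + 3 -> e i = e0 i) :=
    @sat_one_step k P d v a b (F d d a) e le_dv ltac:(lia) eE compF.
  split=> [Eb | [e eE]].
    have [lgP dgP] := cases e0 (fun _ _ => erefl).
    exists e0 => //; right; split; first by apply/lgP.
    by left; split; [apply/dgP | apply/(oneP e0)].
  have [lgP dgP] := cases e eE.
  by case=> [/(not_table e eE)//|[_ [[_ /(oneP e eE)]//|[ndg _]]]]; case: ndg; apply/dgP.
have d_big : sumn P + k + (size P + (3 + k)) + g + 30 <= d by rewrite -/L; lia.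
pose X := 2 ^ (gam * (d - t)).
have A_big : X * 2 ^ (L + 4) <= 2 ^ (g * (d - t)).
  by rewrite -expnD leq_exp2l // /g -addnA mulnDl leq_add2l leq_pmulr // subn_gt0.
have X_gt0 : 0 < X by rewrite expn_gt0.
have L_lt : L + 4 < 2 ^ (L + 4) by apply: ltn_expl.
have S_le : maxn L X + 3 <= 2 ^ (g * (d - t)) by apply: leq_trans A_big; nia.
have T_lt : X < 2 ^ (g * (d - t)) by apply: leq_trans A_big; nia.
have L_le : L <= 2 ^ (g * (d - t)) by apply: leq_trans A_big; nia.
split=> [Eb | [e eE]].
  have [e eE sat_e] := sat_main_complete lt_td d_big le_v' compF S_le T_lt L_le Eb (fun i _ => erefl (e0 i)).
  exists e => //; right; have [lgP dgP] := cases e eE.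
  by split; [apply/lgP | right; split=> // /dgP]; lia.
have [lgP dgP] := cases e eE.
case=> [/(not_table e eE)//|[_ [[/dgP]|[_]]]]; first by lia.
exact: (sat_main_sound lt_td d_big le_v' compF S_le T_lt L_le eE).
Qed.
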